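(* Suppose that $\{\mathbf X(t):t\ge0\}$ is a 2-type Markov branching process with $\mathbf X(0)=\mathbf e_k$ ($k=1,2$), with birth-counting processes $\mathbf Y(t)=(Y_{\mathbf m}(t):\mathbf m\in R_1)$ and $\mathbf Z(t)=(Z_{\mathbf m}(t):\mathbf m\in R_2)$, and let $\tau=\inf\{t\ge0:\mathbf X(t)=\mathbf 0\}$ be its extinction time. For $(\mathbf y,\mathbf z)\in[0,1)^{r_1+r_2}$ let $(q_1(\mathbf y,\mathbf z),q_2(\mathbf y,\mathbf z))$ be the unique solution $\mathbf u\in[0,1]^2$ of $$\begin{cases}B_1(\mathbf u,\mathbf y)+\bar B_1(\mathbf u)=0,\\ B_2(\mathbf u,\mathbf z)+\bar B_2(\mathbf u)=0.\end{cases}$$ (1) If $\rho(\mathbf 1)\le0$, then the probability generating function of $(\mathbf Y(\tau),\mathbf Z(\tau))$ is given by $$E[\mathbf y^{\mathbf Y(\tau)}\mathbf z^{\mathbf Z(\tau)}\mid\mathbf X(0)=\mathbf e_k]=q_k(\mathbf y,\mathbf z),\qquad(\mathbf y,\mathbf z)\in[0,1)^{r_1+r_2},\ k=1,2.$$ (2) If $\rho(\mathbf 1)>0$, then the probability generating function of $(\mathbf Y(\tau),\mathbf Z(\tau))$ conditioned on $\tau<\infty$ is given by $$E[\mathbf y^{\mathbf Y(\tau)}\mathbf z^{\mathbf Z(\tau)}\mid\tau<\infty,\mathbf X(0)=\mathbf e_k]=\frac{q_k(\mathbf y,\mathbf z)}{q_k},\qquad(\mathbf y,\mathbf z)\in[0,1)^{r_1+r_2},\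 k=1,2,$$ where $(q_1,q_2)$ is the minimal nonnegative solution of $B_1(\mathbf u)=0$, $B_2(\mathbf u)=0$.
   Context: Notation: $\mathbf Z_+$ is the set of nonnegative integers; $\mathbf e_1=(1,0)$, $\mathbf e_2=(0,1)$; $\mathbf 0$ and $\mathbf 1$ are vectors of zeros and ones. For $\mathbf x=(x_1,x_2)$ and $\mathbf j=(j_1,j_2)\in\mathbf Z_+^2$, $\mathbf x^{\mathbf j}=x_1^{j_1}x_2^{j_2}$ (with $0^0=1$). Data: for $k=1,2$, $(b^{(k)}_{\mathbf j})_{\mathbf j\in\mathbf Z_+^2}$ are real numbers with $b^{(k)}_{\mathbf j}\ge0$ for $\mathbf j\ne\mathbf e_k$ and $b^{(k)}_{\mathbf e_k}=-\sum_{\mathbf j\neq\mathbf e_k}b^{(k)}_{\mathbf j}$ (finite); $b^{(k)}_{\mathbf j}=0$ for $\mathbf j\notin\mathbf Z_+^2$. Put $B_k(\mathbf x)=\sum_{\mathbf j\in\mathbf Z_+^2}b^{(k)}_{\mathbf j}\mathbf x^{\mathbf j}$ for $\mathbf x\in[0,1]^2$ and $B_{ij}(\mathbf x)=\partial B_i(\mathbf x)/\partial x_j$. $\rho(\mathbf 1)$ denotes the maximal eigenvalue of the matrix $(B_{ij}(1,1):i,j=1,2)$. Standing assumptions: (A-1) there is no $2\times2$ matrix $M$ with $(B_1(\mathbf x),B_2(\mathbf x))=\mathbf xM$; (A-2) $B_{ij}(1,1)<\infty$ for $i,j=1,2$; (A-3) there is an integer $m$ such that all entries of $(B_{ij}(1,1):i,j=1,2)^m$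 are positive. Under these assumptions the system $B_1(\mathbf u)=B_2(\mathbf u)=0$ has a (componentwise) smallest solution in $[0,1]^2$; this is $(q_1,q_2)$. $R_1,R_2\subset\mathbf Z_+^2$ are finite nonempty sets with $b^{(k)}_{\mathbf j}>0$ for all $\mathbf j\in R_k$; $r_k$ is the number of elements of $R_k$; $R_k^c=\mathbf Z_+^2\setminus R_k$. Vectors $\mathbf y=(y_{\mathbf j}:\mathbf j\in R_1)$ and $\mathbf z=(z_{\mathbf j}:\mathbf j\in R_2)$ are indexed by $R_1,R_2$; $\mathbf y^{\mathbf l}=\prod_{\mathbf m\in R_1}y_{\mathbf m}^{l_{\mathbf m}}$ and $\mathbf z^{\tilde{\mathbf l}}=\prod_{\mathbf m\in R_2}z_{\mathbf m}^{\tilde l_{\mathbf m}}$. Define $$B_1(\mathbf x,\mathbf y)=\sum_{\mathbf j\in R_1}b^{(1)}_{\mathbf j}\mathbf x^{\mathbf j}y_{\mathbf j},\quad \bar B_1(\mathbf x)=\sum_{\mathbf j\in R_1^c}b^{(1)}_{\mathbf j}\mathbf x^{\mathbf j},\quad B_2(\mathbf x,\mathbf z)=\sum_{\mathbf j\in R_2}b^{(2)}_{\mathbf j}\mathbf x^{\mathbf j}z_{\mathbf j},\quad \bar B_2(\mathbf x)=\sum_{\mathbf j\in R_2^c}b^{(2)}_{\mathbf j}\mathbf x^{\mathbf j}.$$ For $(\mathbf y,\mathbf z)\in[0,1)^{r_1+r_2}$ the system $B_1(\mathbf u,\mathbf y)+\bar B_1(\mathbf u)=0$, $B_2(\mathbf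 u,\mathbf z)+\bar B_2(\mathbf u)=0$ has exactly one root in $[0,1]^2$. Process: $(\mathbf X(t),\mathbf Y(t),\mathbf Z(t))$ is the continuous-time Markov chain on $\mathbf Z_+^{2}\times\mathbf Z_+^{r_1}\times\mathbf Z_+^{r_2}$ with $Q$-matrix $\tilde Q$ given by $$\tilde q_{(\mathbf i,\mathbf k,\tilde{\mathbf k}),(\mathbf j,\mathbf l,\tilde{\mathbf l})}=i_1b^{(1)}_{\mathbf j-\mathbf i+\mathbf e_1}\,\mathbb 1\{\mathbf l=\mathbf k+I_{R_1}(\mathbf j-\mathbf i+\mathbf e_1)\varepsilon_{\mathbf j-\mathbf i+\mathbf e_1},\ \tilde{\mathbf l}=\tilde{\mathbf k}\}+i_2b^{(2)}_{\mathbf j-\mathbf i+\mathbf e_2}\,\mathbb 1\{\mathbf l=\mathbf k,\ \tilde{\mathbf l}=\tilde{\mathbf k}+I_{R_2}(\mathbf j-\mathbf i+\mathbf e_2)\tilde\varepsilon_{\mathbf j-\mathbf i+\mathbf e_2}\},$$ where $I_{R_k}$ is the indicator of $R_k$ and $\varepsilon_{\mathbf m}\in\mathbf Z_+^{r_1}$ ($\mathbf m\in R_1$), $\tilde\varepsilon_{\mathbf m}\in\mathbf Z_+^{r_2}$ ($\mathbf m\in R_2$) are the unit vectors with $1$ at coordinate $\mathbf m$; initially $\mathbf Y(0)=\mathbf 0$ and $\mathbf Z(0)=\mathbf 0$. Thus $\mathbf X(t)$ is the 2-type Markov branching process in which a type-$a$ individual is replaced by $j_1$ type-1 and $j_2$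 type-2 individuals at rate $b^{(a)}_{\mathbf j}$ ($\mathbf j\neq\mathbf e_a$), and, for $\mathbf m\in R_1$ (resp. $R_2$), $Y_{\mathbf m}(t)$ (resp. $Z_{\mathbf m}(t)$) counts the type-1 (resp. type-2) individuals that have split into offspring vector $\mathbf m$ up to time $t$. Under the standing assumptions the chain is regular (non-explosive). Conditioning on $\tau<\infty$ is elementary conditioning on an event and presupposes that the event has positive probability. *)

(* Defs.v *)
From HB Require Import structures.
From mathcomp Require Import all_boot all_order all_algebra.
From mathcomp Require Import finmap.
From mathcomp Require Import all_classical all_reals all_analysis.

Set Implicit Arguments.
Unset Strict Implicit.
Unset Printing Implicit Defensive.

Import Order.TTheory GRing.Theory Num.Theory.
Import numFieldNormedType.Exports.

Local Open Scope classical_set_scope.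
Local Open Scope ring_scope.

(* Types 1 and 2 of the process are the elements 0 and 1 of 'I_2. *)
Definition Zp2 : countType := {ffun 'I_2 -> nat}.

Definition evec (k : 'I_2) : Zp2 := [ffun i => (i == k : nat)].

Definition zvec : Zp2 := [ffun => 0%N].

(* j - i + e_k when this vector lies in Z_+^2, None otherwise. *)
Definition offspring (k : 'I_2) (i j : Zp2) : option Zp2 :=
  if [forall a, (i a <= j a + evec k a)%N]
  then Some [ffun a => (j a + evec k a - i a)%N] else None.

Section generating_functions.
Variable R : realType.
Implicit Types (x u : 'rV[R]_2) (j : Zp2) (S : {fset Zp2}).

(* Unordered sum of a real family: sum of the positive parts minus sum of the
   negative parts; meaningful for absolutely summable families. *)
Definition usum (T : choiceType) (D : set T) (f : T -> R) : R :=
  fine (\esum_(i in D) (Num.max (f i) 0)%:E)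
  - fine (\esum_(i in D) (Num.max (- f i) 0)%:E).

Definition ones : 'rV[R]_2 := const_mx 1.

Definition unit_square : set 'rV[R]_2 :=
  [set x | forall k, 0 <= x 0 k <= 1].

Definition xpow x j : R := \prod_(k < 2) x 0 k ^+ j k.

Definition offspring_rates (b : 'I_2 -> Zp2 -> R) : Prop :=
  (forall k j, j != evec k -> 0 <= b k j) /\
  (forall k, \esum_(j in [set j | j != evec k]) (b k j)%:E
             = (- b k (evec k))%:E)%E.

Section one_type.
Variable bk : Zp2 -> R.

Definition Bfun x : R := usum setT (fun j => bk j * xpow x j).

(* B_k(x, y), the sum over S = R_k. *)
Definition Bmarked S (y : S -> R) x : R :=
  \sum_(m : S) bk (val m) * xpow x (val m) * y m.

(* \bar B_k(x), the sum over the complement of S = R_k. *)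
Definition Bbar S x : R :=
  usum [set j | j \notin S] (fun j => bk j * xpow x j).

(* Partial derivative of B_k in the l-th variable at a point x of the square,
   B_k being defined on the square only: one-sided at the boundary, possibly
   +oo. *)
Definition Bpartial (l : 'I_2) x : \bar R :=
  lim ((((Bfun (x + h *: delta_mx 0 l) - Bfun x) / h)%:E
       @[h --> within [set h | 0 <= x 0 l + h <= 1] (0 : R)^'])%classic).

End one_type.

Section two_types.
Variable b : 'I_2 -> Zp2 -> R.

Definition Bmatrix : 'M[R]_2 :=
  \matrix_(i, l) fine (Bpartial (b i) l ones).

(* The off-diagonal entries being nonnegative, both eigenvalues of the matrix
   are real. *)
Definition rho1 : R := sup [set a | eigenvalue Bmatrix a].

Definition assumption_A1 : Prop :=
  ~ exists M : 'M[R]_2,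
      forall x, unit_square x -> \row_k Bfun (b k) x = x *m M.

Definition assumption_A2 : Prop :=
  forall i l, (Bpartial (b i) l ones < +oo)%E.

(* m ranges over all integers: no positive power of the matrix can be positive
   when rho1 <= 0, whereas negative even powers can when rho1 < 0. For a
   singular matrix, _^-1 is the identity function in MathComp, so that negative
   m add nothing to positive ones. *)
Definition assumption_A3 : Prop :=
  exists m : int, forall i l, 0 < (Bmatrix ^ m) i l.

Definition extinction_root u : Prop :=
  unit_square u /\ forall k, Bfun (b k) u = 0.

(* (q_1, q_2) *)
Definition qmin : 'rV[R]_2 :=
  get [set u | extinction_root u /\
               forall v, extinction_root v -> forall k, u 0 k <= v 0 k].

(* (q_1(y,z), q_2(y,z)); for y, z with values in [0, 1) there is exactly one
   root in the square. *)
Definition qroot (R1 R2 : {fset Zp2}) (y : R1 -> R) (z : R2 -> R) : 'rV[R]_2 :=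
  get [set u | [/\ unit_square u,
                   Bmarked (b 0) y u + Bbar (b 0) R1 u = 0
                 & Bmarked (b 1) z u + Bbar (b 1) R2 u = 0]].

End two_types.
End generating_functions.

Definition counts (S : {fset Zp2}) : countType := {ffun S -> nat}.

Definition state (R1 R2 : {fset Zp2}) : countType :=
  (Zp2 * counts R1 * counts R2)%type.

(* k + I_S(m) eps_m *)
Definition count_incr (S : {fset Zp2}) (m : Zp2) (k : counts S) : counts S :=
  [ffun m' : S => (k m' + (val m' == m))%N].

Definition qtilde (R : realType) (b : 'I_2 -> Zp2 -> R) (R1 R2 : {fset Zp2})
    (s s' : state R1 R2) : R :=
  let: (i, k, k') := s in
  let: (j, l, l') := s' in
  (i 0)%:R * (if offspring 0 i j is Some m
              then b 0 m * ((l == count_incr m k) && (l' == k'))%:R else 0)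
  + (i 1)%:R * (if offspring 1 i j is Some m
                then b 1 m * ((l == k) && (l' == count_incr m k'))%:R else 0).

Section markov_chains.
Variables (R : realType) (T : countType).

(* Honest standard transition function with Q-matrix q. *)
Definition transition_function (q : T -> T -> R) (p : R -> T -> T -> R) : Prop :=
  [/\ forall (t : R) i j, 0 <= t -> 0 <= p t i j,
      forall (t : R) i, 0 <= t -> (\esum_(j in setT) (p t i j)%:E = 1)%E,
      forall i j, p 0 i j = (i == j)%:R,
      forall (s t : R) i j, 0 <= s -> 0 <= t ->
        (\esum_(l in setT) (p s i l * p t l j)%:E = (p (s + t) i j)%:E)%E
    & forall i j, (p t i j - (i == j)%:R) / t @[t --> 0^'+] --> q i j].

(* Continuous-time Markov chain (W t)_{t >= 0} with Q-matrix q and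
   right-continuous paths for the discrete topology of T. *)
Definition markov_chain (q : T -> T -> R) d (Omega : measurableType d)
    (P : probability Omega R) (W : R -> Omega -> T) : Prop :=
  [/\ forall (t : R) i, 0 <= t -> measurable [set w | W t w = i],
      forall (t : R) w, 0 <= t -> \forall u \near t^'+, W u w = W t w
    & exists2 p, transition_function q p &
      forall (n : nat) (t : nat -> R) (i : nat -> T),
        0 <= t 0%N -> (forall m, t m <= t m.+1) ->
        (P [set w | forall m, (m <= n)%N -> W (t m) w = i m]
         = P [set w | W (t 0%N) w = i 0%N]
           * (\prod_(m < n) p (t m.+1 - t m) (i m) (i m.+1))%:E)%E].

End markov_chains.

Section extinction.
Variables (R : realType) (d : measure_display) (Omega : measurableType d).

Definition extinction_time (X : R -> Omega -> Zp2) (w : Omega) : \bar R :=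
  ereal_inf [set t%:E | t in [set t : R | 0 <= t /\ X t w = zvec]].

Definition extinct (X : R -> Omega -> Zp2) : set Omega :=
  [set w | (extinction_time X w < +oo)%E].

Definition cpow (S : {fset Zp2}) (y : S -> R) (l : counts S) : R :=
  \prod_(m : S) y m ^+ l m.

(* y^{Y(tau)} z^{Z(tau)}; off the event tau < +oo the value is irrelevant. *)
Definition marked_at_extinction (R1 R2 : {fset Zp2}) (X : R -> Omega -> Zp2)
    (Y : R -> Omega -> counts R1) (Z : R -> Omega -> counts R2)
    (y : R1 -> R) (z : R2 -> R) (w : Omega) : R :=
  let tau := fine (extinction_time X w) in
  cpow y (Y tau w) * cpow z (Z tau w).

(* Elementary conditional expectation E[f | A], for P A > 0. *)
Definition cond_expectation (P : probability Omega R) (A : set Omega)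
    (f : Omega -> R) : R :=
  fine (\int[P]_(w in A) (f w)%:E)%E / fine (P A).

End extinction.

(* Main.v *)
Require Import Defs.
From HB Require Import structures.
From mathcomp Require Import all_boot all_order all_algebra.
From mathcomp Require Import finmap zify ring lra.
From mathcomp Require Import all_classical all_reals all_analysis measurable_realfun.

Set Implicit Arguments.
Unset Strict Implicit.
Unset Printing Implicit Defensive.

Import Order.TTheory GRing.Theory Num.Theory.
Import numFieldNormedType.Exports.

Local Open Scope classical_set_scope.
Local Open Scope ring_scope.

(** Let [u] be a root of the two equations. Since individuals evolve independently
    of each other, the mean of u^X(t) y^Y(t) z^Z(t) does not depend on [t]: in terms
    of the rates, the function [state_gf u y z] is harmonic ([state_gf_balance]). At
    time 0 it equals [u 0 k]. At large times only the extinct populations contribute,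
    because the weight y^Y(t) z^Z(t) of a population that is still alive decays
    exponentially in mean: every individual that splits may hit a mark below 1
    ([alive_gf_drift], [uniform_gap]). So [u 0 k] is the limit of the mean of
    y^Y(t) z^Z(t) over the populations extinct at time [t] ([cvg_extinct_gf]), which
    is the integral of y^Y(tau) z^Z(tau) over the event of extinction
    ([cvg_avg_hit], [integral_marked]).

    The transition function of the chain is known through its derivative at 0 only.
    Passing from the rates to the means requires that nothing comes in from infinity.
    This is the content of the maximum principle [avg_decay]: time is cut into small
    steps, over which a mean differs from its Euler approximation by a small error,
    uniformly on finite sets of states ([avg_short_time]), and the size of the state
    serves as a barrier outside a finite set. The size is a barrier because the mean
    offspring numbers are finite, being the derivatives of [Bfun] at [ones]
    ([BpartialE], [size_state_drift]).

    Roots exist as least supersolutions ([least_rootP]). The probability of extinction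
    is the least root of the unmarked equations ([probability_extinct]): it is at most
    this root by comparison with a harmonic function, and at least its approximations
    by marks tending to 1 ([least_root_approx]). This gives the case of a positive
    maximal eigenvalue. When the maximal eigenvalue is nonpositive, convexity forces
    the root to be [ones] ([subcritical_root]), so that extinction is certain. *)

(** * Sums of nonnegative families *)

Section nonnegative_sums.
Local Open Scope ereal_scope.
Variable R : realType.

Lemma esumZl (T : choiceType) (D : set T) (c : R) (a : T -> \bar R) :
  (0 <= c)%R -> (forall i, 0 <= a i) ->
  \esum_(i in D) (c%:E * a i) = c%:E * \esum_(i in D) a i.
Proof.
move=> c0 a0; rewrite /esum -ereal_supZl//; last first.
  by apply/set0P; exists 0; exists set0; rewrite ?fsbig_set0//; exact: fsets_set0.
congr ereal_sup; apply/seteqP; split=> [_ [X XD <-]|_ [_ [X XD <-] <-]] /=.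
  by exists (\sum_(x \in X) a x); [exists X|rewrite ge0_mule_fsumr].
by exists X => //; rewrite ge0_mule_fsumr.
Qed.

Lemma esumD1 (T : choiceType) (t : T) (a : T -> \bar R) :
  (forall i, 0 <= a i) ->
  \esum_(i in setT) a i = a t + \esum_(i in [set i | i != t]) a i.
Proof.
move=> a0; rewrite (esumID [set t])//; congr (_ + _).
  by rewrite setTI esum_set1.
by congr esum; apply/seteqP; split=> [i [_ /= /eqP]|i /= /eqP].
Qed.

Lemma esum_le_finite (T : choiceType) (D : set T) (a : T -> \bar R) (M : \bar R) :
  (forall F : {fset T}, [set` F] `<=` D -> \sum_(i <- F) a i <= M) ->
  \esum_(i in D) a i <= M.
Proof.
move=> aM; apply: ge_ereal_sup => _ [X [fX XD] <-].
rewrite fsbig_finite//; apply: aM => i /=.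
by rewrite in_fset_set// inE => /XD.
Qed.

Lemma esum_ge_finite (T : choiceType) (D : set T) (a : T -> \bar R)
    (F : {fset T}) :
  [set` F] `<=` D -> \sum_(i <- F) a i <= \esum_(i in D) a i.
Proof.
move=> FD; apply: ereal_sup_ubound; exists [set` F]; first by split.
by rewrite fsbig_finite//= set_fsetK.
Qed.

Lemma exchange_esum (T1 T2 : choiceType) (a : T1 -> T2 -> \bar R) :
  (forall i j, 0 <= a i j) ->
  \esum_(i in setT) \esum_(j in setT) a i j
  = \esum_(j in setT) \esum_(i in setT) a i j.
Proof.
move=> a0; rewrite !esum_esum//.
rewrite (reindex_esum (setT `*`` (fun=> setT)) _ (fun x : T2 * T1 => (x.2, x.1)))//.
split=> //=; first by move=> [i1 i2] [j1 j2] /= _ _ [] -> ->.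
by move=> [i1 i2] _ /=; exists (i2, i1).
Qed.

Lemma esumD_fset (T : choiceType) (D : set T) (F : {fset T}) (a : T -> \bar R) :
  [set` F] `<=` D -> (forall i, D i -> 0 <= a i) ->
  \esum_(i in D) a i
  = \sum_(i <- F) a i + \esum_(i in D `\` [set` F]) a i.
Proof.
move=> FD a0; rewrite (esumID [set` F])// (setIidr FD) -setDE; congr (_ + _).
rewrite esum_fset// => [|i /set_mem/FD/a0//].
by rewrite fsbig_finite//= set_fsetK.
Qed.

End nonnegative_sums.

(** * The semigroup of a transition function *)

Section semigroup.
Local Open Scope ereal_scope.
Variables (R : realType) (T : countType).
Variables (q : T -> T -> R) (p : R -> T -> T -> R).
Hypothesis p_tf : transition_function q p.

(** The semigroup of [p] acting on functions: the mean of [x] at time [t] for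
    the chain started at [s]. *)
Definition avg (t : R) (x : T -> \bar R) (s : T) : \bar R :=
  \esum_(j in setT) ((p t s j)%:E * x j).

Let p_ge0 t i j : (0 <= t)%R -> (0 <= p t i j)%R.
Proof. by case: p_tf => + _ _ _ _; apply. Qed.

Lemma avg_ge0 t x s : (0 <= t)%R -> (forall j, 0 <= x j) -> 0 <= avg t x s.
Proof. by move=> t0 x0; apply: esum_ge0 => j _; rewrite mule_ge0// lee_fin p_ge0. Qed.

Lemma avg_le t x y s : (0 <= t)%R -> (forall j, x j <= y j) -> avg t x s <= avg t y s.
Proof. by move=> t0 xy; apply: le_esum => j _; rewrite lee_wpmul2l// lee_fin p_ge0. Qed.

Lemma avg_cst t (c : R) s : (0 <= t)%R -> (0 <= c)%R -> avg t (cst c%:E) s = c%:E.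
Proof.
move=> t0 c0; rewrite /avg; under eq_esum do rewrite muleC.
rewrite esumZl// => [|i]; last by rewrite lee_fin p_ge0.
by case: p_tf => _ -> // _ _ _; rewrite mule1.
Qed.

Lemma avg_le1 t x s : (0 <= t)%R -> (forall j, x j <= 1) -> avg t x s <= 1.
Proof. by move=> t0 x1; rewrite -(avg_cst s t0 (@ler01 R)) avg_le. Qed.

Lemma avgD t x y s : (0 <= t)%R -> (forall j, 0 <= x j) -> (forall j, 0 <= y j) ->
  avg t (fun j => x j + y j) s = avg t x s + avg t y s.
Proof.
move=> t0 x0 y0; rewrite /avg -esumD; last 2 first.
- by move=> i _; rewrite mule_ge0// lee_fin p_ge0.
- by move=> i _; rewrite mule_ge0// lee_fin p_ge0.
by apply: eq_esum => j _; rewrite ge0_muleDr.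
Qed.

Lemma avg0 x s : (forall j, 0 <= x j) -> avg 0 x s = x s.
Proof.
move=> x0; rewrite /avg (esumD1 s) => [|i]; last by rewrite mule_ge0// lee_fin p_ge0.
case: p_tf => _ _ p0 _ _; rewrite p0 eqxx mul1e esum1 ?adde0// => i /= si.
by rewrite p0 eq_sym (negbTE si) mul0e.
Qed.

Lemma avg_semigroup t u x s : (0 <= t)%R -> (0 <= u)%R ->
  (forall j, 0 <= x j <= 1) -> avg (t + u) x s = avg t (avg u x) s.
Proof.
move=> t0 u0 x01; have x0 j : 0 <= x j by case/andP: (x01 j).
rewrite /avg.
transitivity (\esum_(j in setT) \esum_(l in setT) ((p t s l * p u l j)%:E * x j)).
  apply: eq_esum => j _; case: p_tf => _ _ _ <- // _.
  have := x01 j; case: (x j) => [r| |//]; last by rewrite leye_eq andbF.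
  move=> /andP[r0 _].
  rewrite muleC -esumZl// => [|i]; last by rewrite lee_fin mulr_ge0 ?p_ge0.
  by apply: eq_esum => l _; rewrite muleC.
rewrite exchange_esum => [|i j]; last first.
  by rewrite mule_ge0// lee_fin mulr_ge0 ?p_ge0.
apply: eq_esum => l _.
rewrite -esumZl ?p_ge0// => [|i]; last by rewrite mule_ge0// lee_fin p_ge0.
by apply: eq_esum => j _; rewrite EFinM muleA.
Qed.

End semigroup.

(** * Short times *)

Section short_time.
Local Open Scope ereal_scope.
Variables (R : realType) (T : countType).
Variables (q : T -> T -> R) (p : R -> T -> T -> R).
Hypothesis p_tf : transition_function q p.
Hypothesis q_conservative : forall s,
  \esum_(j in [set j | j != s]) (q s j)%:E = (- q s s)%:E.

(** The Euler step of the backward equation, up to an error [h * e]. *)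
Definition euler_bound (h e : R) (s : T) : Prop :=
  forall x : T -> \bar R, (forall j, 0 <= x j <= 1) ->
    avg p h x s <= (1 + h * q s s)%:E * x s
      + h%:E * (\esum_(j in [set j | j != s]) ((q s j)%:E * x j))
      + (h * e)%:E.

(** The derivative of [p] at 0 is given entrywise only. It is uniform over all
    [x] with values in [[0, 1]] because no mass is lost: [p h s] and, [q] being
    conservative, its first order expansion both have total mass 1, so that a
    finite set of states carrying almost all the rate out of [s] controls the
    remaining ones (Scheffe's argument). *)
Lemma avg_short_time (s : T) (e : R) : (0 < e)%R ->
  \forall h \near 0^'+, euler_bound h e s.
Proof.
move=> e0; have p_ge0 t i j : (0 <= t)%R -> (0 <= p t i j)%R.
  by case: p_tf => + _ _ _ _; apply.
have e5 : (0 < e / 5)%R by rewrite divr_gt0.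
(* F carries all but e / 5 of the rate at which s is left; the error h * e is
   made of five parts h * (e / 5): one for s, one for F, three for the rest *)
have [F Fs qF] : exists2 F : {fset T}, [set` F] `<=` [set j | j != s]
    & (- q s s - e / 5 < \sum_(j <- F) q s j)%R.
  have [|_ [X [fX Xs] <-]] := @ub_ereal_sup_adherent R
      [set \sum_(j \in A) (q s j)%:E | A in fsets [set j | j != s]] _ e5.
    by have := q_conservative s; rewrite /esum => ->.
  have := q_conservative s; rewrite /esum => -> Xe.
  exists (fset_set X); first by move=> j /=; rewrite in_fset_set// inE => /Xs.
  by move: Xe; rewrite fsbig_finite//= sumEFin -EFinB lte_fin.
pose eta := (e / 5 / (#|` F|.+1)%:R)%R.
have eta0 : (0 < eta)%R by rewrite divr_gt0.
have Feta : ((#|` F|)%:R * eta <= e / 5)%R.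
  rewrite /eta mulrCA ler_piMr// ?(ltW e5)// ler_pdivrMr// mul1r ler_nat.
  exact: leqnSn.
have near_q j : \forall h \near (0 : R)^'+,
    (`|q s j - (p h s j - (s == j)%:R) / h| <= eta)%R.
  by case: p_tf => _ _ _ _ /(_ s j) /cvgrPdist_le; apply.
have near_F : \forall h \near (0 : R)^'+, forall j : F,
    (`|q s (val j) - (p h s (val j) - (s == val j)%:R) / h| <= eta)%R.
  by apply: filter_forall => j; exact: near_q.
apply: filterS3 near_F (near_q s) (nbhs_right_gt (0 : R)) => h hF hs h0.
have pF j : j \in F -> (h * q s j - h * eta <= p h s j <= h * q s j + h * eta)%R.
  move=> jF; have : (`|q s j - (p h s j - (s == j)%:R) / h| <= eta)%R.
    exact: (hF [` jF]%fset).
  have /negbTE -> : s != j by rewrite eq_sym; exact: Fs.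
  rewrite subr0 ler_norml -(ler_pM2l h0) -[X in _ && X](ler_pM2l h0).
  rewrite mulrBr mulrCA divff ?gt_eqF// mulr1 => /andP[h1 h2].
  by apply/andP; split; lra.
have ps : (1 + h * q s s - h * eta <= p h s s <= 1 + h * q s s + h * eta)%R.
  move: hs; rewrite eqxx mulr1n ler_norml -(ler_pM2l h0) -[X in _ && X](ler_pM2l h0).
  rewrite mulrBr [X in (_ <= _ - X)%R]mulrCA [X in (_ - X <= _)%R]mulrCA.
  rewrite divff ?gt_eqF// mulr1 => /andP[h1 h2].
  by apply/andP; split; lra.
move=> x x01; pose y j := fine (x j).
have xE j : x j = (y j)%:E.
  rewrite /y fineK// fin_numE; have := x01 j; case: (x j) => //=.
  by rewrite leye_eq andbF.
have y01 j : (0 <= y j <= 1)%R by rewrite -!lee_fin -xE.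
have y0 j : (0 <= y j)%R by case/andP: (y01 j).
have y1 j : (y j <= 1)%R by case/andP: (y01 j).
pose rest := fine (\esum_(j in [set j | j != s] `\` [set` F]) (p h s j)%:E).
have p0 j : 0 <= (p h s j)%:E by rewrite lee_fin p_ge0// ltW.
have rest0 : 0 <= \esum_(j in [set j | j != s] `\` [set` F]) (p h s j)%:E.
  by apply: esum_ge0 => j _; exact: p0.
have psum : (p h s s)%:E + (\sum_(j <- F) (p h s j)%:E
    + \esum_(j in [set j | j != s] `\` [set` F]) (p h s j)%:E) = 1.
  case: p_tf => _ /(_ h s (ltW h0)) <- _ _ _.
  by rewrite [in RHS](esumD1 s)// (esumD_fset Fs).
have restE : \esum_(j in [set j | j != s] `\` [set` F]) (p h s j)%:E = rest%:E.
  rewrite /rest fineK// ge0_fin_numE// (@le_lt_trans _ _ 1) ?ltry//.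
  rewrite -psum addeA leeDr// adde_ge0//; apply: sume_ge0 => //.
move: psum; rewrite restE sumEFin -!EFinD => -[psum].
have sumF : (h * \sum_(j <- F) q s j - h * (e / 5) <= \sum_(j <- F) p h s j)%R.
  apply: (@le_trans _ _ (\sum_(j <- F) (h * q s j - h * eta)))%R.
    rewrite sumrB -mulr_sumr lerB// -mulr_sumr ler_pM2l//.
    by rewrite big_const_seq count_predT iter_addr_0 mulr_natl in Feta *.
  by rewrite big_seq [leRHS]big_seq ler_sum// => j /pF /andP[].
rewrite /avg (esumD1 s) => [|j]; last by rewrite mule_ge0//; case/andP: (x01 j).
rewrite [in leLHS](esumD_fset Fs) => [|j _]; last first.
  by rewrite mule_ge0//; case/andP: (x01 j).
have le_qx : (h * \sum_(j <- F) q s j * y j)%:E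
    <= h%:E * \esum_(j in [set j | j != s]) ((q s j)%:E * x j).
  rewrite EFinM lee_pmul2l ?lte_fin// -sumEFin.
  apply: le_trans (esum_ge_finite _ Fs); apply: lee_sum => j _.
  by rewrite xE.
have le_F : \sum_(j <- F) (p h s j)%:E * x j
    <= (h * \sum_(j <- F) q s j * y j)%:E + (h * (e / 5))%:E.
  rewrite big_seq; under eq_bigr do rewrite xE -EFinM.
  rewrite sumEFin -EFinD lee_fin.
  apply: (@le_trans _ _ (\sum_(j <- F) (h * (q s j * y j) + h * eta)))%R.
    rewrite -big_seq [leLHS]big_seq [leRHS]big_seq ler_sum// => j jF.
    have /andP[_ /(ler_wpM2r (y0 j)) h1] := pF j jF.
    rewrite (le_trans h1)// mulrDl mulrA lerD2l ler_piMr// mulr_ge0 ?ltW//.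
  rewrite big_split/= -mulr_sumr lerD2l big_const_seq count_predT iter_addr_0.
  by rewrite -mulrnAr ler_pM2l// -mulr_natl.
have le_rest : \esum_(j in [set j | j != s] `\` [set` F]) ((p h s j)%:E * x j)
    <= rest%:E.
  rewrite -restE; apply: le_esum => j _.
  by rewrite xE -EFinM lee_fin ler_piMr// p_ge0// ltW.
have eta_le : (eta <= e / 5)%R.
  by rewrite /eta ler_pdivrMr// ler_peMr ?(ltW e5)// ler1n.
have rest_le : (rest <= h * (e / 5) + h * (e / 5) + h * eta)%R.
  have /andP[ps1 _] := ps.
  have := ler_wpM2l (ltW h0) (ltW qF); rewrite mulrBr; lra.
have le_s : (p h s s)%:E * x s <= ((1 + h * q s s) * y s + h * eta)%:E.
  have /andP[_ ps2] := ps.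
  rewrite xE -EFinM lee_fin (le_trans (ler_wpM2r (y0 s) ps2))// mulrDl lerD2l.
  by rewrite ler_piMr// mulr_ge0 ?ltW.
apply: (le_trans (leeD le_s (leeD le_F le_rest))).
apply: (@le_trans _ _ ((1 + h * q s s)%:E * x s
    + (h * \sum_(j <- F) q s j * y j)%:E + (h * e)%:E)).
  2: by rewrite leeD// leeD.
rewrite xE -!EFinM -!EFinD lee_fin.
have h1 : (h * eta <= h * (e / 5))%R by rewrite ler_pM2l.
lra.
Qed.

End short_time.

(** * The maximum principle *)

Section comparison.
Local Open Scope ereal_scope.
Variables (R : realType) (T : countType).
Variables (q : T -> T -> R) (p : R -> T -> T -> R).
Hypothesis p_tf : transition_function q p.
Hypothesis q_ge0 : forall s j, j != s -> (0 <= q s j)%R.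
Hypothesis q_conservative : forall s,
  \esum_(j in [set j | j != s]) (q s j)%:E = (- q s s)%:E.
Variables (V : T -> R) (C : R).
Hypothesis V_ge1 : forall s, (1 <= V s)%R.
Hypothesis V_finite : forall K : R, finite_set [set s | (V s <= K)%R].
Hypothesis C_ge0 : (0 <= C)%R.
Hypothesis V_drift : forall s,
  \esum_(j in [set j | j != s]) (q s j * V j)%:E <= ((C - q s s) * V s)%:E.

(** Induction on the number of time steps. Where [V] exceeds [e^-1] the bound is
    above 1, hence trivial; the finitely many other states obey the Euler bound
    for one common step [h]. The unit added to [C] absorbs the error [h * e]. *)
Lemma avg_decay_approx (U : T -> R) (k e h : R) (s : T) (n : nat) :
  (0 <= k)%R -> (0 <= k * h <= 1)%R -> (0 < e)%R -> (0 < h)%R ->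
  (forall s, 0 <= U s <= 1)%R ->
  (forall s, \esum_(j in [set j | j != s]) (q s j * U j)%:E
             <= ((- k - q s s) * U s)%:E) ->
  (forall s, (V s <= e^-1)%R -> (0 <= 1 + h * q s s)%R /\ euler_bound q p h e s) ->
  avg p (n%:R * h) (EFin \o U) s
    <= ((1 - k * h) ^+ n * U s + e * (1 + (C + 1) * h) ^+ n * V s)%:E.
Proof.
move=> k0 kh e0 h0 U01 U_drift step; elim: n s => [|n IH] s.
  rewrite mul0r (avg0 p_tf) => [|j]; last by rewrite lee_fin; case/andP: (U01 j).
  by rewrite /= lee_fin !expr0 mulr1 mul1r lerDl mulr_ge0// ?ltW// (lt_le_trans ltr01).
set B := (1 + (C + 1) * h)%R.
have B1 : (1 <= B)%R by rewrite lerDl mulr_ge0 ?addr_ge0// ltW.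
have Bn1 m : (1 <= B ^+ m)%R by rewrite exprn_ege1.
have nh0 : (0 <= n%:R * h)%R by rewrite mulr_ge0// ltW.
have xU01 j : 0 <= (U j)%:E <= 1 by rewrite !lee_fin.
have U0 j : (0 <= U j)%R by case/andP: (U01 j).
have a0 m : (0 <= (1 - k * h) ^+ m)%R.
  by rewrite exprn_ge0// subr_ge0; case/andP: kh.
have [sV|Vs] := leP (V s) (e^-1)%R; last first.
  apply: (@le_trans _ _ 1).
    apply: (avg_le1 p_tf) => [|j]; first by rewrite mulr_ge0// ltW.
    by case/andP: (xU01 j).
  rewrite lee_fin -[leLHS]add0r lerD ?mulr_ge0//.
  rewrite -[leLHS](mulfV (lt0r_neq0 e0)) ler_pM ?invr_ge0 ?(ltW e0) ?(ltW Vs)//.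
  by rewrite ler_peMr ?Bn1 ?(ltW e0).
have [qs0 {}step] := step s sV.
rewrite -natr1 mulrDl mul1r addrC (avg_semigroup p_tf) ?(ltW h0)//.
set x := avg p (n%:R * h) (EFin \o U) in IH *.
have x01 j : 0 <= x j <= 1.
  rewrite (avg_ge0 p_tf) => [|//|i]; last by case/andP: (xU01 i).
  by rewrite (avg_le1 p_tf)// => i; case/andP: (xU01 i).
apply: (le_trans (step _ x01)).
set a := ((1 - k * h) ^+ n)%R in IH; have an0 : (0 <= a)%R := a0 n.
set A := (e * B ^+ n)%R in IH.
have A0 : (0 <= A)%R by rewrite mulr_ge0 ?(ltW e0)// (le_trans ler01).
have eA : (e <= A)%R by rewrite ler_peMr ?Bn1 ?(ltW e0).
have V0 j : (0 <= V j)%R by rewrite (le_trans ler01).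
(* the absolute values extend the nonnegative rates to the diagonal *)
have sum_le : \esum_(j in [set j | j != s]) ((q s j)%:E * x j)
    <= (a * ((- k - q s s) * U s) + A * ((C - q s s) * V s))%:E.
  apply: (@le_trans _ _ (\esum_(j in [set j | j != s])
      (a%:E * (`|q s j| * U j)%:E + A%:E * (`|q s j| * V j)%:E))).
    apply: le_esum => j /= js; rewrite ger0_norm ?q_ge0//.
    rewrite -!EFinM -EFinD mulrCA (mulrCA A) -mulrDr EFinM.
    by rewrite lee_wpmul2l ?lee_fin ?q_ge0// IH.
  rewrite esumD => [|j _|j _]; last 2 first.
  - by rewrite -EFinM lee_fin (mulr_ge0 an0)// mulr_ge0.
  - by rewrite -EFinM lee_fin (mulr_ge0 A0)// mulr_ge0.
  rewrite !esumZl ?an0// => [|j|j]; last 2 first.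
  - by rewrite lee_fin mulr_ge0.
  - by rewrite lee_fin mulr_ge0.
  rewrite EFinD !(EFinM a) !(EFinM A) leeD// lee_wpmul2l ?lee_fin ?an0//.
    apply: le_trans (U_drift s); apply: le_esum => j js.
    by rewrite ger0_norm ?q_ge0.
  apply: le_trans (V_drift s); apply: le_esum => j js.
  by rewrite ger0_norm ?q_ge0.
apply: (@le_trans _ _ (((1 + h * q s s) * (a * U s + A * V s))
    + h * (a * ((- k - q s s) * U s) + A * ((C - q s s) * V s)) + h * e)%:E).
  rewrite [leRHS]EFinD leeD// [leRHS]EFinD leeD//.
    by rewrite EFinM lee_wpmul2l ?lee_fin// -EFinD IH.
  by rewrite EFinM lee_wpmul2l ?lee_fin ?(ltW h0).
rewrite lee_fin !exprS -/a [X in (_ <= _ + X * V s)%R](_ : _ = B * A)%R.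
  2: by rewrite /A mulrCA.
have heV : (h * e <= h * (A * V s))%R.
  by rewrite ler_wpM2l ?(ltW h0)// (le_trans eA)// ler_peMr.
rewrite /B; lra.
Qed.

(** A maximum principle for every semigroup with the given rates, minimal or not:
    if [U] is bounded and its drift is at most [- k U], then its mean decays like
    [expR (- k t)]. The function [V], whose sublevel sets are finite and whose
    drift is at most [C V], plays the part of a barrier at infinity; it enters
    with an arbitrarily small factor. *)
Lemma avg_decay (U : T -> R) (k t : R) (s : T) :
  (0 <= k)%R -> (0 <= t)%R -> (forall s, 0 <= U s <= 1)%R ->
  (forall s, \esum_(j in [set j | j != s]) (q s j * U j)%:E
             <= ((- k - q s s) * U s)%:E) ->
  avg p t (EFin \o U) s <= (expR (- (k * t)) * U s)%:E.
Proof.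
move=> k0; rewrite le_eqVlt => /predU1P[<- U01 _|t0 U01 U_drift].
  rewrite mulr0 oppr0 expR0 mul1r (avg0 p_tf)// => j.
  by rewrite lee_fin; case/andP: (U01 j).
have U0 j : (0 <= U j)%R by case/andP: (U01 j).
have EV0 : (0 < expR ((C + 1) * t) * V s)%R.
  by rewrite mulr_gt0 ?expR_gt0// (lt_le_trans ltr01).
apply/lee_addgt0Pr => e0 e0_gt0.
(* e is such that the barrier contributes at most e0 at time t *)
pose e := (e0 / (expR ((C + 1) * t) * V s))%R.
have e_gt0 : (0 < e)%R by rewrite divr_gt0.
have good : \forall h \near (0 : R)^'+, forall s, (V s <= e^-1)%R ->
    (0 <= 1 + h * q s s)%R /\ euler_bound q p h e s.
  have qs0 s' : (q s' s' <= 0)%R.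
    rewrite -oppr_ge0 -lee_fin -q_conservative; apply: esum_ge0 => j /= js.
    by rewrite lee_fin q_ge0.
  pose F := fset_set [set s | (V s <= e^-1)%R].
  have : \forall h \near (0 : R)^'+, forall s' : F,
      (0 <= 1 + h * q (val s') (val s'))%R /\ euler_bound q p h e (val s').
    apply: filter_forall => s'; have := qs0 (val s'); set Q := q _ _ => Q0.
    have Q1 : (0 < 1 - Q)%R by rewrite subr_gt0 (le_lt_trans Q0).
    have h1 : \forall h \near (0 : R)^'+, (h < (1 - Q)^-1)%R.
      by apply: nbhs_right_lt; rewrite invr_gt0.
    have h2 := avg_short_time p_tf q_conservative (val s') e_gt0.
    apply: filterS3 h1 h2 (nbhs_right_gt (0 : R)) => h h1 h2 h3; split=> //.
    move: h1; rewrite -[X in (_ < X)%R]mul1r ltr_pdivlMr// => h1.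
    by rewrite -/Q; lra.
  apply: filterS => h hF s' Vs'.
  have s'F : s' \in F by rewrite in_fset_set// inE.
  exact: (hF [` s'F]%fset).
have good_k : \forall h \near (0 : R)^'+, (k * h <= 1)%R.
  have k1 : (0 < 1 + k)%R by rewrite ltr_pwDl.
  have h1 : \forall h \near (0 : R)^'+, (h < (1 + k)^-1)%R.
    by apply: nbhs_right_lt; rewrite invr_gt0.
  apply: filterS2 h1 (nbhs_right_gt (0 : R)) => h h1 h2.
  move: h1; rewrite -[X in (_ < X)%R]mul1r ltr_pdivlMr// => h1; lra.
have [n [h [h0 nh hk hgood]]] : exists n h, [/\ (0 < h)%R, (n%:R * h = t)%R,
   (k * h <= 1)%R & forall s, (V s <= e^-1)%R ->
    (0 <= 1 + h * q s s)%R /\ euler_bound q p h e s].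
  have [d /= d0 dgood] := filterI good good_k.
  pose n := (Num.truncn (t / d)).+1.
  have n0 : (0 < n%:R :> R)%R by rewrite ltr0n.
  have tn0 : (0 < t / n%:R)%R by rewrite divr_gt0.
  exists n, (t / n%:R)%R; have [|//|] := dgood (t / n%:R)%R.
    rewrite /ball/= sub0r normrN gtr0_norm// ltr_pdivrMr// mulrC -ltr_pdivrMr//.
    exact: truncnS_gt.
  by split=> //; rewrite mulrCA divff ?mulr1// gt_eqF.
have kh : (0 <= k * h <= 1)%R by rewrite hk mulr_ge0 ?(ltW h0).
rewrite -nh.
apply: (le_trans (avg_decay_approx s n k0 kh e_gt0 h0 U01 U_drift hgood)).
rewrite -EFinD lee_fin lerD//.
  rewrite ler_wpM2r//.
  rewrite (_ : (- (k * (n%:R * h)) = n%:R * (- (k * h)))%R); last by ring.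
  rewrite expRM_natl lerXn2r ?nnegrE ?expR_ge0 ?subr_ge0//.
  exact: expR_ge1Dx.
have Bn : ((1 + (C + 1) * h) ^+ n <= expR ((C + 1) * t))%R.
  rewrite -nh (_ : (C + 1) * (n%:R * h) = n%:R * ((C + 1) * h))%R; last by ring.
  rewrite expRM_natl lerXn2r ?nnegrE ?expR_ge0//.
    by rewrite addr_ge0// mulr_ge0 ?addr_ge0 ?(ltW h0).
  exact: expR_ge1Dx.
apply: (@le_trans _ _ (e * (expR ((C + 1) * t) * V s)))%R.
  rewrite -mulrA ler_wpM2l ?(ltW e_gt0)// ler_wpM2r//.
  exact: le_trans ler01 (V_ge1 s).
by rewrite /e divfK// gt_eqF.
Qed.

End comparison.

(** * The jumps of the branching process with marks *)

Lemma ord2P (a : 'I_2) : a = 0 \/ a = 1.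
Proof.
case: a => [[|[|//]]] h; [left|right]; exact: val_inj.
Qed.

Lemma sum2 (M : nmodType) (F : 'I_2 -> M) : \sum_(a < 2) F a = F 0 + F 1.
Proof.
rewrite big_ord_recl big_ord1; congr (F _ + F _).
by apply: val_inj.
Qed.

Lemma prod2 (M : pzSemiRingType) (F : 'I_2 -> M) : \prod_(a < 2) F a = F 0 * F 1.
Proof.
rewrite big_ord_recl big_ord1; congr (F _ * F _).
by apply: val_inj.
Qed.

Definition total (i : Zp2) : nat := (i 0%R + i 1%R)%N.

Section jumps.
Variables (R1 R2 : {fset Zp2}).

(** The population once an individual of type [a] has been replaced by the
    offspring [m]; meaningful when [i] has an individual of type [a]. *)
Definition split_type (a : 'I_2) (m i : Zp2) : Zp2 :=
  [ffun c => (i c + m c - evec a c)%N].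

Definition jump (a : 'I_2) (m : Zp2) (s : state R1 R2) : state R1 R2 :=
  (split_type a m s.1.1,
   if a == 0 then count_incr m s.1.2 else s.1.2,
   if a == 0 then s.2 else count_incr m s.2).

Lemma evec_le (a : 'I_2) (i : Zp2) c : (0 < i a)%N -> (evec a c <= i c)%N.
Proof. by rewrite ffunE; case: eqP => [->|]. Qed.

Lemma offspring_split (a : 'I_2) (m i : Zp2) : (0 < i a)%N ->
  offspring a i (split_type a m i) = Some m.
Proof.
move=> ia; rewrite /offspring ifT.
  congr Some; apply/ffunP => c; rewrite !ffunE.
  have := @evec_le a i c ia; rewrite ffunE => h.
  by rewrite subnK ?addKn// (leq_trans h)// leq_addr.
apply/forallP => c; rewrite [split_type _ _ _ c]ffunE subnK ?leq_addr//.
by rewrite (leq_trans (evec_le c ia))// leq_addr.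
Qed.

Lemma offspringE (a : 'I_2) (i j m : Zp2) : offspring a i j = Some m ->
  j = split_type a m i.
Proof.
rewrite /offspring; case: ifP => // /forallP ij [<-]; apply/ffunP => c.
by rewrite !ffunE; have := ij c; rewrite !ffunE => /subnKC ->; rewrite addnK.
Qed.

Lemma jump_inj (a : 'I_2) (s : state R1 R2) : (0 < s.1.1 a)%N ->
  injective (jump a ^~ s).
Proof.
move=> sa m m' [/(congr1 (offspring a s.1.1))].
by rewrite !offspring_split// => -[].
Qed.

Lemma count_incr_notin (S : {fset Zp2}) m (l : counts S) : m \notin S ->
  count_incr m l = l.
Proof.
move=> mS; apply/ffunP => m'; rewrite ffunE; case: eqP => [m'm|_]; last first.
  by rewrite addn0.
by move: mS; rewrite -m'm (valP m').
Qed.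

(** The diagonal rates [b a (evec a)] belong to jumps that do not move, since the
    marked offspring vectors differ from [evec a]. *)
Lemma jump_evec (a : 'I_2) (s : state R1 R2) :
  evec 0 \notin R1 -> evec 1 \notin R2 -> jump a (evec a) s = s.
Proof.
case: s => [[i l] l'] e1 e2; rewrite /jump/=; congr (_, _, _).
- by apply/ffunP => c; rewrite ffunE addnK.
- by case: (ord2P a) => -> //=; rewrite count_incr_notin.
- by case: (ord2P a) => -> //=; rewrite count_incr_notin.
Qed.

Variables (R : realType) (b : 'I_2 -> Zp2 -> R).
Hypothesis b_rates : offspring_rates b.
Hypothesis evec_R1 : evec 0 \notin R1.
Hypothesis evec_R2 : evec 1 \notin R2.

Lemma b_ge0 a m : m != evec a -> 0 <= b a m.
Proof. by case: b_rates => + _; apply. Qed.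

Lemma b_evec a : \esum_(m in [set m | m != evec a]) (b a m)%:E = (- b a (evec a))%:E.
Proof. by case: b_rates. Qed.

Lemma death_ge0 a : 0 <= - b a (evec a).
Proof.
rewrite -lee_fin -b_evec; apply: esum_ge0 => m /= me.
by rewrite lee_fin b_ge0.
Qed.

Definition jump_rate (a : 'I_2) (s s' : state R1 R2) : R :=
  if offspring a s.1.1 s'.1.1 is Some m then b a m * (s' == jump a m s)%:R else 0.

Lemma qtildeE (s s' : state R1 R2) :
  qtilde b s s' = \sum_(a < 2) (s.1.1 a)%:R * jump_rate a s s'.
Proof.
rewrite sum2 /jump_rate; case: s => [[i l] l']; case: s' => [[j k] k'] /=.
by congr (_ * _ + _ * _); case E : offspring => [m|//]; congr (_ * _%:R);
  rewrite !xpair_eqE -(offspringE E) eqxx.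
Qed.

Lemma jump_rate_ge0 a s s' : s' != s -> 0 <= jump_rate a s s'.
Proof.
rewrite /jump_rate => ss'; case: offspring => [m|//].
case: eqP => [s'E|]; last by rewrite mulr0.
rewrite mulr1 b_ge0//; apply: contra ss' => /eqP mE.
by rewrite s'E mE jump_evec.
Qed.

Lemma jump_rate_jump a m (s : state R1 R2) : (0 < s.1.1 a)%N ->
  jump_rate a s (jump a m s) = b a m.
Proof. by move=> sa; rewrite /jump_rate/= offspring_split// eqxx mulr1. Qed.

Lemma qtilde_ge0 (s s' : state R1 R2) : s' != s -> 0 <= qtilde b s s'.
Proof.
by move=> ss'; rewrite qtildeE sumr_ge0// => a _; rewrite mulr_ge0// jump_rate_ge0.
Qed.

Lemma qtilde_diag (s : state R1 R2) :
  qtilde b s s = - \sum_(a < 2) (s.1.1 a)%:R * (- b a (evec a)).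
Proof.
rewrite qtildeE -sumrN; apply: eq_bigr => a _; rewrite mulrN opprK.
have [->|sa] := posnP (s.1.1 a); first by rewrite !mul0r.
by rewrite -{3}(jump_evec a s)// jump_rate_jump.
Qed.

(** The jumps out of [s] are indexed by the type that splits and by its
    offspring: [jump] is injective in the offspring when the type is present. *)
Lemma esum_qtilde (G : state R1 R2 -> R) (s : state R1 R2) :
  (forall s', 0 <= G s') ->
  (\esum_(s' in [set s' | s' != s]) (qtilde b s s' * G s')%:E
   = \sum_(a < 2) (s.1.1 a)%:R%:E
     * \esum_(m in [set m | m != evec a]) (b a m * G (jump a m s))%:E)%E.
Proof.
move=> G0.
transitivity (\esum_(s' in [set s' | s' != s])
    (\sum_(a < 2) (s.1.1 a)%:R%:E * (jump_rate a s s' * G s')%:E)%E).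
  apply: eq_esum => s' _; rewrite qtildeE mulr_suml -sumEFin.
  by apply: eq_bigr => a _; rewrite -mulrA.
rewrite esum_sum => [|s' a ss' _]; last first.
  by rewrite -EFinM lee_fin !mulr_ge0 ?jump_rate_ge0.
apply: eq_bigr => a _.
have [sa0|sa] := posnP (s.1.1 a).
  by rewrite sa0 mul0e esum1// => s' _; rewrite mul0e.
rewrite [RHS](_ : _ = \esum_(m in [set m | m != evec a])
    (s.1.1 a)%:R%:E * `|b a m * G (jump a m s)|%:E)%E; last first.
  rewrite esumZl => [|//|m]; last by rewrite lee_fin.
  congr (_ * _)%E; apply: eq_esum => m /= me.
  by rewrite ger0_norm// mulr_ge0// b_ge0.
rewrite (esumID (jump a ^~ s @` [set m | m != evec a])) => [|s' /= ss']; last first.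
  by rewrite -EFinM lee_fin !mulr_ge0 ?jump_rate_ge0.
rewrite [X in (_ + X)%E]esum1 ?adde0; last first.
  move=> s' [/= ss' himg]; rewrite /jump_rate; case: offspring => [m|]; last first.
    by rewrite mul0r mule0.
  case: eqP => [s'E|_]; last by rewrite mulr0 mul0r mule0.
  case: himg; exists m; last by rewrite s'E.
  by apply: contra ss' => /eqP mE; rewrite s'E mE jump_evec.
rewrite setIidr; last first.
  move=> _ [m /= me <-]; apply: contra me => /eqP js.
  by apply/eqP/(jump_inj sa); rewrite js jump_evec.
rewrite esum_image => [|m m' _ _]; last exact: jump_inj.
apply: eq_esum => m /= me; rewrite jump_rate_jump// ger0_norm//.
by rewrite mulr_ge0// b_ge0.
Qed.

Lemma qtilde_conservative (s : state R1 R2) :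
  \esum_(s' in [set s' | s' != s]) (qtilde b s s')%:E = (- qtilde b s s)%:E.
Proof.
transitivity (\esum_(s' in [set s' | s' != s]) (qtilde b s s' * 1)%:E).
  by apply: eq_esum => s' _; rewrite mulr1.
rewrite esum_qtilde// qtilde_diag opprK -sumEFin; apply: eq_bigr => a _.
rewrite EFinM -b_evec; congr (_ * _)%E; apply: eq_esum => m _.
by rewrite mulr1.
Qed.

End jumps.

(** * Generating functions of a state *)

Section generating_function.
Variables (R : realType) (R1 R2 : {fset Zp2}).
Implicit Types (u : 'rV[R]_2) (y : R1 -> R) (z : R2 -> R).

Definition mark (S : {fset Zp2}) (y : S -> R) (m : Zp2) : R :=
  if insub m is Some m' then y m' else 1.

Definition mark2 y z (a : 'I_2) : Zp2 -> R := if a == 0 then mark y else mark z.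

Definition state_gf u y z (s : state R1 R2) : R :=
  xpow u s.1.1 * (cpow y s.1.2 * cpow z s.2).

Lemma cpow_incr (S : {fset Zp2}) (y : S -> R) m (l : counts S) :
  cpow y (count_incr m l) = mark y m * cpow y l.
Proof.
rewrite /mark; case: insubP => [m' mS m'E|mS]; last by rewrite count_incr_notin ?mul1r.
rewrite /cpow (bigD1 m')//= [in RHS](bigD1 m')//= mulrA; congr (_ * _).
  by rewrite ffunE m'E eqxx addn1 exprS.
apply: eq_bigr => i im; rewrite ffunE -m'E.
by rewrite (inj_eq val_inj) (negbTE im) addn0.
Qed.

Lemma xpow_ge0 u m : unit_square u -> 0 <= xpow u m.
Proof.
by move=> u01; apply: prodr_ge0 => c _; rewrite exprn_ge0//; case/andP: (u01 c).
Qed.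

Lemma xpow_le1 u m : unit_square u -> xpow u m <= 1.
Proof.
move=> u01; apply: prodr_ile1 => c _; have /andP[u0 u1] := u01 c.
by rewrite exprn_ge0// exprn_ile1.
Qed.

Lemma cpow01 (S : {fset Zp2}) (y : S -> R) l :
  (forall m, 0 <= y m <= 1) -> 0 <= cpow y l <= 1.
Proof.
move=> y01; apply/andP; split.
  by apply: prodr_ge0 => c _; rewrite exprn_ge0//; case/andP: (y01 c).
apply: prodr_ile1 => c _; have /andP[u0 u1] := y01 c.
by rewrite exprn_ge0// exprn_ile1.
Qed.

Lemma mark01 (S : {fset Zp2}) (y : S -> R) m :
  (forall m, 0 <= y m <= 1) -> 0 <= mark y m <= 1.
Proof. by move=> y01; rewrite /mark; case: insub => [//|]; rewrite lexx ler01. Qed.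

Lemma mark2_01 y z a m : (forall m, 0 <= y m <= 1) -> (forall m, 0 <= z m <= 1) ->
  0 <= mark2 y z a m <= 1.
Proof. by move=> y01 z01; rewrite /mark2; case: ifP => _; rewrite mark01. Qed.

Lemma state_gf01 u y z s : unit_square u ->
  (forall m, 0 <= y m <= 1) -> (forall m, 0 <= z m <= 1) ->
  0 <= state_gf u y z s <= 1.
Proof.
move=> u01 y01 z01; have /andP[y0 y1] := cpow01 s.1.2 y01.
have /andP[z0 z1] := cpow01 s.2 z01.
rewrite /state_gf !mulr_ge0//= ?xpow_ge0// mulr_ile1// ?mulr_ge0 ?xpow_ge0 ?xpow_le1//.
by rewrite mulr_ile1.
Qed.

(** [v] stands for the quotient of [xpow u i] by [u 0 a], a division that could
    not be made when this coordinate vanishes. *)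
Lemma xpow_split u (a : 'I_2) (i : Zp2) : unit_square u -> (0 < i a)%N ->
  exists v, [/\ 0 <= v, xpow u i = v * u 0 a
    & forall m, xpow u (split_type a m i) = v * xpow u m].
Proof.
move=> u01 ia; exists (xpow u [ffun c => (i c - evec a c)%N]).
rewrite /xpow; split=> [||m]; first exact: xpow_ge0.
  rewrite [RHS](_ : _ = (\prod_(c < 2) u 0 c ^+ (i c - evec a c)) *
      \prod_(c < 2) u 0 c ^+ evec a c).
    rewrite -big_split/=; apply: eq_bigr => c _.
    by rewrite -exprD subnK// evec_le.
  congr (_ * _); first by apply: eq_bigr => c _; rewrite ffunE.
  rewrite (bigD1 a)//= big1 => [|c ca]; rewrite ffunE ?eqxx ?expr1 ?mulr1//.
  by rewrite (negbTE ca).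
rewrite -big_split/=; apply: eq_bigr => c _; rewrite !ffunE -exprD.
by rewrite addnC -addnBA ?(addnC (m c))//; have := evec_le c ia; rewrite ffunE.
Qed.

Lemma state_gf_jump u y z (a : 'I_2) (s : state R1 R2) :
  unit_square u -> (forall m, 0 <= y m <= 1) -> (forall m, 0 <= z m <= 1) ->
  (0 < s.1.1 a)%N ->
  exists v, [/\ 0 <= v, state_gf u y z s = v * u 0 a
    & forall m, state_gf u y z (jump a m s) = v * (mark2 y z a m * xpow u m)].
Proof.
move=> u01 y01 z01 sa; have [v [v0 sE jE]] := xpow_split u01 sa.
have /andP[y0 _] := cpow01 s.1.2 y01; have /andP[z0 _] := cpow01 s.2 z01.
exists (v * (cpow y s.1.2 * cpow z s.2)); split=> [||m].
- by rewrite !mulr_ge0.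
- by rewrite /state_gf sE; ring.
rewrite /state_gf/= jE /mark2; case: ifP => _; rewrite cpow_incr; ring.
Qed.

Variable b : 'I_2 -> Zp2 -> R.
Hypothesis b_rates : offspring_rates b.
Hypothesis evec_R1 : evec 0 \notin R1.
Hypothesis evec_R2 : evec 1 \notin R2.

(** The two equations for the roots read
    [split_gf y z a u = - b a (evec a) * u 0 a]: the diagonal term, the only
    one that may be negative, is moved to the other side. *)
Definition split_gf y z (a : 'I_2) u : \bar R :=
  \esum_(m in [set m | m != evec a]) (b a m * (mark2 y z a m * xpow u m))%:E.

(** Branching property at the level of the rates: when an individual of type [a]
    splits, its factor [u 0 a] is replaced by the generating function of its
    marked offspring. *)
Lemma esum_qtilde_gf u y z (s : state R1 R2) :
  unit_square u -> (forall m, 0 <= y m <= 1) -> (forall m, 0 <= z m <= 1) ->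
  exists v : 'I_2 -> R, [/\ forall a, 0 <= v a,
    forall a, (s.1.1 a)%:R * state_gf u y z s = (s.1.1 a)%:R * (v a * u 0 a)
    & (\esum_(s' in [set s' | s' != s]) (qtilde b s s' * state_gf u y z s')%:E
       = \sum_(a < 2) ((s.1.1 a)%:R * v a)%:E * split_gf y z a u)%E].
Proof.
move=> u01 y01 z01.
have gf0 s' : 0 <= state_gf u y z s' by case/andP: (state_gf01 s' u01 y01 z01).
pose has_v a v := [/\ 0 <= v,
  (s.1.1 a)%:R * state_gf u y z s = (s.1.1 a)%:R * (v * u 0 a)
  & (0 < s.1.1 a)%N -> forall m, state_gf u y z (jump a m s)
                       = v * (mark2 y z a m * xpow u m)].
have /choice[v vP] : forall a, exists v, has_v a v.
  move=> a; have [s0|sa] := posnP (s.1.1 a).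
    by exists 0; split; rewrite ?s0 ?mul0r.
  have [v [v0 sE jE]] := state_gf_jump u01 y01 z01 sa.
  by exists v; split => //; rewrite sE.
exists v; split=> [a|a|]; [by case: (vP a)|by case: (vP a)|].
rewrite esum_qtilde//; apply: eq_bigr => a _; rewrite EFinM -muleA.
have [s0|sa] := posnP (s.1.1 a); first by rewrite s0 !mul0e.
congr (_ * _)%E; have [va0 _ /(_ sa) jE] := vP a.
rewrite /split_gf (@eq_esum _ _ [set m | m != evec a]
  (fun m => (b a m * (mark2 y z a m * xpow u m))%:E)
  (fun m => `|b a m * (mark2 y z a m * xpow u m)|%:E)); last first.
  move=> m /= me; rewrite ger0_norm// !mulr_ge0 ?(b_ge0 b_rates) ?xpow_ge0//.
  by case/andP: (mark2_01 a m y01 z01).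
rewrite -esumZl => [|//|m]; last by rewrite lee_fin.
apply: eq_esum => m /= me; rewrite jE -EFinM ger0_norm ?(mulrCA (v a))//.
rewrite !mulr_ge0 ?(b_ge0 b_rates) ?xpow_ge0//.
by case/andP: (mark2_01 a m y01 z01).
Qed.

(** Harmonic functions: at a root the generating function of the offspring gives
    back the factor [u 0 a] that the split has removed. *)
Lemma state_gf_balance u y z (s : state R1 R2) :
  unit_square u -> (forall m, 0 <= y m <= 1) -> (forall m, 0 <= z m <= 1) ->
  (forall a, split_gf y z a u = (- b a (evec a) * u 0 a)%:E) ->
  \esum_(s' in [set s' | s' != s]) (qtilde b s s' * state_gf u y z s')%:E
  = (- qtilde b s s * state_gf u y z s)%:E.
Proof.
move=> u01 y01 z01 uroot; have [v [v0 vE ->]] := esum_qtilde_gf s u01 y01 z01.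
rewrite qtilde_diag// opprK mulr_suml -sumEFin; apply: eq_bigr => a _.
rewrite uroot -EFinM; congr EFin.
by rewrite [RHS]mulrAC vE; ring.
Qed.

Lemma qtilde_extinct (s s' : state R1 R2) : s.1.1 = zvec -> qtilde b s s' = 0.
Proof.
move=> s0; rewrite qtildeE// big1// => a _.
by rewrite s0 ffunE mul0r.
Qed.

Definition alive_gf y z (s : state R1 R2) : R :=
  (s.1.1 != zvec)%:R * (cpow y s.1.2 * cpow z s.2).

(** A split multiplies the weight of the marks by the mark of the offspring, and
    each individual contributes at least [k] to the resulting rate of loss; a
    living population has at least one individual. Extinct populations stay
    extinct, so that the indicator can only lower the drift. *)
Lemma alive_gf_drift y z (k : R) (s : state R1 R2) :
  0 <= k -> (forall m, 0 <= y m <= 1) -> (forall m, 0 <= z m <= 1) ->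
  (forall a, split_gf y z a (ones R) <= (- b a (evec a) - k)%:E)%E ->
  (\esum_(s' in [set s' | s' != s]) (qtilde b s s' * alive_gf y z s')%:E
  <= ((- k - qtilde b s s) * alive_gf y z s)%:E)%E.
Proof.
move=> k0 y01 z01 yk; rewrite /alive_gf.
have [s0|s_alive] := eqVneq s.1.1 zvec.
  by rewrite mul0r mulr0 esum1// => s' _; rewrite qtilde_extinct// mul0r.
have ones01 : unit_square (ones R) by move=> a; rewrite mxE ler01 lexx.
have onesE (s' : state R1 R2) : state_gf (ones R) y z s' = cpow y s'.1.2 * cpow z s'.2.
  by rewrite /state_gf /xpow big1 ?mul1r// => a _; rewrite mxE expr1n.
have cc0 (s' : state R1 R2) : 0 <= cpow y s'.1.2 * cpow z s'.2.
  by rewrite -onesE; case/andP: (state_gf01 s' ones01 y01 z01).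
apply: (@le_trans _ _ (\esum_(s' in [set s' | s' != s])
    (qtilde b s s' * state_gf (ones R) y z s')%:E)%E).
  apply: le_esum => s' /= ss'; rewrite lee_fin ler_wpM2l ?qtilde_ge0// onesE.
  by case: (_ == _) => /=; rewrite ?mul0r ?mul1r.
have [v [v0 vE ->]] := esum_qtilde_gf s ones01 y01 z01.
rewrite mul1r -onesE.
apply: (@le_trans _ _ (\sum_(a < 2)
  (((s.1.1 a)%:R * v a)%:E * (- b a (evec a) - k)%:E)%E)%E).
  by apply: lee_sum => a _; rewrite lee_wpmul2l// lee_fin mulr_ge0.
under eq_bigr do rewrite -EFinM; rewrite sumEFin lee_fin.
have vE' a : (s.1.1 a)%:R * v a = (s.1.1 a)%:R * state_gf (ones R) y z s.
  by rewrite vE mxE mulr1.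
rewrite (eq_bigr (fun a => (s.1.1 a)%:R * (- b a (evec a)) * state_gf (ones R) y z s
   - (s.1.1 a)%:R * (k * state_gf (ones R) y z s))); last first.
  by move=> a _; rewrite vE'; ring.
rewrite sumrB -!mulr_suml qtilde_diag// opprK [leRHS]mulrDl mulNr [leRHS]addrC.
rewrite lerD2l lerN2 -natr_sum ler_peMl//.
  by rewrite mulr_ge0// onesE.
rewrite ler1n lt0n sum2.
apply: contra s_alive; rewrite addn_eq0 => /andP[/eqP i0 /eqP i1].
by apply/eqP/ffunP => c; rewrite ffunE; case: (ord2P c) => ->.
Qed.

End generating_function.

(** * Long times: the marks at extinction *)

Section extinction_gf.
Variables (R : realType) (R1 R2 : {fset Zp2}) (b : 'I_2 -> Zp2 -> R).
Hypothesis b_rates : offspring_rates b.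
Hypothesis evec_R1 : evec 0 \notin R1.
Hypothesis evec_R2 : evec 1 \notin R2.
Variable C : R.
Hypothesis C_ge0 : 0 <= C.
Hypothesis b_mean : forall a,
  (\esum_(m in [set m | m != evec a]) (b a m * (total m)%:R)%:E <= C%:E)%E.

(** The barrier used for the maximum principle. The counts are part of it, so that
    its sublevel sets are finite. *)
Definition size_state (s : state R1 R2) : nat :=
  (1 + total s.1.1 + \sum_m s.1.2 m + \sum_m s.2 m)%N.

Lemma sum_count_incr (S : {fset Zp2}) m (l : counts S) :
  (\sum_m' count_incr m l m' <= \sum_m' l m' + 1)%N.
Proof.
have [mS|mS] := boolP (m \in S); last by rewrite count_incr_notin ?leq_addr.
rewrite (bigD1 [` mS]%fset)//= [in leqRHS](bigD1 [` mS]%fset)//=.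
rewrite ffunE eqxx [in leqRHS]addnAC leq_add2l leq_sum// => i im.
by rewrite ffunE -[m]/(val [` mS]%fset) (inj_eq val_inj) (negbTE im) addn0.
Qed.

(** At most one count increases, by one, and the individual that splits leaves. *)
Lemma size_jump (a : 'I_2) m (s : state R1 R2) : (0 < s.1.1 a)%N ->
  (size_state (jump a m s) <= size_state s + total m)%N.
Proof.
move=> sa; rewrite /size_state /total /jump /= !ffunE.
have := sum_count_incr m s.1.2; have := sum_count_incr m s.2.
set A := (\sum_m' _)%N; set A' := (\sum_m' _)%N => h1.
set B := (\sum_m' _)%N; set B' := (\sum_m' _)%N => h2.
have [e10 e01] : ((1 == 0 :> 'I_2) = false) * ((0 == 1 :> 'I_2) = false) by [].
case: (ord2P a) sa => -> sa; rewrite ?e10 ?e01 ?eqxx /= -?/A -?/B -?/A' -?/B';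
  move: (s.1.1 0) (s.1.1 1) (m 0) (m 1) sa => i0 i1 m0 m1 sa; clear -h1 h2 sa; lia.
Qed.

Lemma size_state_finite (K : R) :
  finite_set [set s | (size_state s)%:R <= K].
Proof.
have fin_bounded (I : finType) (n : nat) :
    finite_set [set f : {ffun I -> nat} | forall x, (f x <= n)%N].
  apply: (@sub_finite_set _ _ ((fun g : {ffun I -> 'I_n.+1} =>
      [ffun x => val (g x)]) @` setT)); last first.
    by apply: finite_image; exact: finite_finset.
  move=> f /= fn; exists [ffun x => inord (f x)] => //.
  by apply/ffunP => x; rewrite !ffunE/= inordK// ltnS.
pose n := Num.truncn K.
apply: sub_finite_set (finite_setX (finite_setX (fin_bounded 'I_2 n)
  (fin_bounded R1 n)) (fin_bounded R2 n)) => s /= sK.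
have {sK} : (size_state s <= n)%N.
  have K0 : 0 <= K by apply: le_trans sK.
  by rewrite truncn_ge_nat.
have parts (i0 i1 l l' : nat) : (1 + (i0 + i1) + l + l' <= n)%N ->
    [/\ i0 <= n, i1 <= n, l <= n & l' <= n]%N by move=> h; split; lia.
move=> /parts[n0 n1 nl nl']; split; first split => x.
- by case: (ord2P x) => ->.
- by apply: leq_trans nl; rewrite (bigD1 x)//= leq_addr.
- by move=> x; apply: leq_trans nl'; rewrite (bigD1 x)//= leq_addr.
Qed.

(** Finite mean offspring: the rate of increase of the size is at most
    proportional to the number of individuals. *)
Lemma size_state_drift (s : state R1 R2) :
  (\esum_(s' in [set s' | s' != s]) (qtilde b s s' * (size_state s')%:R)%:E
  <= ((C - qtilde b s s) * (size_state s)%:R)%:E)%E.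
Proof.
rewrite esum_qtilde//.
apply: (@le_trans _ _ (\sum_(a < 2) ((s.1.1 a)%:R
    * (- b a (evec a) * (size_state s)%:R + C))%:E)%E).
  apply: lee_sum => a _; rewrite EFinM.
  have [->|sa] := posnP (s.1.1 a); first by rewrite !mul0e.
  rewrite lee_wpmul2l// EFinD EFinM -b_evec//.
  have b_norm m : m != evec a -> `|b a m| = b a m.
    by move=> me; rewrite ger0_norm// b_ge0.
  apply: (@le_trans _ _ (\esum_(m in [set m | m != evec a])
      ((size_state s)%:R%:E * `|b a m|%:E + (`|b a m| * (total m)%:R)%:E)%E)%E).
    apply: le_esum => m /= me; rewrite -EFinM -EFinD lee_fin b_norm//.
    rewrite (mulrC _%:R) -mulrDr ler_wpM2l ?(b_ge0 b_rates)// -natrD ler_nat.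
    exact: size_jump.
  rewrite esumD => [|m _|m _]; last 2 first.
  - by rewrite mule_ge0// lee_fin.
  - by rewrite lee_fin mulr_ge0.
  rewrite esumZl => [|//|m]; last by rewrite lee_fin.
  rewrite muleC leeD//.
    by rewrite lee_wpmul2r ?lee_fin// le_esum// => m /= me; rewrite b_norm.
  by apply: le_trans (b_mean a); apply: le_esum => m /= me; rewrite b_norm.
rewrite sumEFin lee_fin.
rewrite (eq_bigr (fun a => (s.1.1 a)%:R * (- b a (evec a)) * (size_state s)%:R
  + (s.1.1 a)%:R * C)); last by move=> a _; rewrite mulrDr mulrA.
rewrite big_split/= -!mulr_suml qtilde_diag// opprK [leRHS]mulrDl [leRHS]addrC.
rewrite lerD2l mulrC ler_wpM2l// -natr_sum ler_nat sum2.
rewrite -[X in (X <= _)%N]/(total s.1.1) /size_state; move: (total _) => i.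
by rewrite -!addnA addnCA leq_addr.
Qed.

Section semigroup.
Variable p : R -> state R1 R2 -> state R1 R2 -> R.
Hypothesis p_tf : transition_function (@qtilde R b R1 R2) p.
Variables (y : R1 -> R) (z : R2 -> R).
Hypothesis y01 : forall m, 0 <= y m <= 1.
Hypothesis z01 : forall m, 0 <= z m <= 1.

Lemma avg_qtilde_decay (U : state R1 R2 -> R) (k t : R) (s : state R1 R2) :
  0 <= k -> 0 <= t -> (forall s, 0 <= U s <= 1) ->
  (forall s, \esum_(s' in [set s' | s' != s]) (qtilde b s s' * U s')%:E
             <= ((- k - qtilde b s s) * U s)%:E)%E ->
  (avg p t (EFin \o U) s <= (expR (- (k * t)) * U s)%:E)%E.
Proof.
apply: (avg_decay p_tf (qtilde_ge0 b_rates evec_R1 evec_R2)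
  (qtilde_conservative b_rates evec_R1 evec_R2)
  _ size_state_finite C_ge0 size_state_drift).
by move=> s'; rewrite ler1n /size_state -!addnA.
Qed.

(** The maximum principle applied to the harmonic function [state_gf u y z] and
    to its complement to 1. *)
Lemma avg_state_gf u (t : R) (s : state R1 R2) : 0 <= t -> unit_square u ->
  (forall a, split_gf b y z a u = (- b a (evec a) * u 0 a)%:E) ->
  avg p t (EFin \o state_gf u y z) s = (state_gf u y z s)%:E.
Proof.
move=> t0 u01 uroot.
have gf01 s' : 0 <= state_gf u y z s' <= 1 by exact: state_gf01.
pose co s' := 1 - state_gf u y z s'.
have co01 s' : 0 <= co s' <= 1.
  by have /andP[? ?] := gf01 s'; rewrite /co subr_ge0 lerBlDr lerDl; apply/andP.
have le_gf : (avg p t (EFin \o state_gf u y z) s <= (state_gf u y z s)%:E)%E.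
  have := @avg_qtilde_decay (state_gf u y z) 0 t s.
  rewrite mul0r oppr0 expR0 mul1r; apply => // s'.
  by rewrite state_gf_balance// sub0r.
have le_co : (avg p t (EFin \o co) s <= (co s)%:E)%E.
  have := @avg_qtilde_decay co 0 t s.
  rewrite mul0r oppr0 expR0 mul1r; apply => // s'.
  rewrite sub0r /co.
  set q_gf := \esum_(s'' in _) _.
  have q_gf_le : (q_gf + (- qtilde b s' s' * state_gf u y z s')%:E
      <= (- qtilde b s' s')%:E)%E.
    rewrite -(state_gf_balance b_rates evec_R1 evec_R2 s' u01 y01 z01 uroot).
    rewrite -qtilde_conservative// -esumD => [|s''/= ss|s'' /= ss]; last 2 first.
    - by rewrite lee_fin mulr_ge0 ?qtilde_ge0//; case/andP: (co01 s'').
    - by rewrite lee_fin mulr_ge0 ?qtilde_ge0//; case/andP: (gf01 s'').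
    by apply: le_esum => s'' _; rewrite -EFinD lee_fin -mulrDr subrK mulr1.
  by rewrite mulrBr mulr1 EFinB leeBrDr.
have sum1 : (avg p t (EFin \o state_gf u y z) s + avg p t (EFin \o co) s = 1)%E.
  rewrite -(avgD p_tf) => [|//|j|j]; last 2 first.
  - by rewrite lee_fin; case/andP: (gf01 j).
  - by rewrite lee_fin; case/andP: (co01 j).
  rewrite -(avg_cst p_tf s t0 ler01); congr (avg _ _ _ _); apply/funext => j.
  by rewrite /= -EFinD /co addrC subrK.
apply/eqP; rewrite eq_le le_gf/=.
have := leeD2l (avg p t (EFin \o state_gf u y z) s) le_co.
by rewrite sum1 /co -leeBlDr// -EFinB opprB addrC subrK.
Qed.

Definition extinct_gf (s : state R1 R2) : R :=
  (s.1.1 == zvec)%:R * (cpow y s.1.2 * cpow z s.2).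

Lemma extinct_gf01 s : 0 <= extinct_gf s <= 1.
Proof.
have /andP[y0 y1] := cpow01 s.1.2 y01; have /andP[z0 z1] := cpow01 s.2 z01.
rewrite /extinct_gf; case: (_ == _); rewrite ?mul0r ?lexx ?ler01// mul1r.
by rewrite mulr_ge0// mulr_ile1.
Qed.

Lemma avg_extinct_gf_le u (t : R) (s : state R1 R2) : 0 <= t -> unit_square u ->
  (forall a, split_gf b y z a u = (- b a (evec a) * u 0 a)%:E) ->
  (avg p t (EFin \o extinct_gf) s <= (state_gf u y z s)%:E)%E.
Proof.
move=> t0 u01 uroot; rewrite -(avg_state_gf s t0 u01 uroot).
apply: (avg_le p_tf) => // j; rewrite lee_fin /extinct_gf.
case: eqP => [j0|_]; last by rewrite mul0r; case/andP: (state_gf01 j u01 y01 z01).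
by rewrite mul1r /state_gf /xpow j0 big1 ?mul1r// => a _; rewrite ffunE expr0.
Qed.

(** The part of the conserved quantity [state_gf u y z] that is carried by living
    populations is at most [alive_gf y z], whose mean vanishes exponentially. *)
Lemma avg_extinct_gf_ge u (k t : R) (s : state R1 R2) :
  0 <= k -> 0 <= t -> unit_square u ->
  (forall a, split_gf b y z a u = (- b a (evec a) * u 0 a)%:E) ->
  (forall a, split_gf b y z a (ones R) <= (- b a (evec a) - k)%:E)%E ->
  ((state_gf u y z s - expR (- (k * t)))%:E <= avg p t (EFin \o extinct_gf) s)%E.
Proof.
move=> k0 t0 u01 uroot yk.
have alive01 s' : 0 <= alive_gf y z s' <= 1.
  have /andP[? ?] := cpow01 s'.1.2 y01; have /andP[? ?] := cpow01 s'.2 z01.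
  rewrite /alive_gf; case: (_ == _); rewrite ?mul0r ?lexx ?ler01// mul1r.
  by rewrite mulr_ge0// mulr_ile1.
have alive_le : (avg p t (EFin \o alive_gf y z) s <= (expR (- (k * t)))%:E)%E.
  apply: (le_trans (avg_qtilde_decay s k0 t0 alive01 _)) => [s'|].
    exact: alive_gf_drift.
  by rewrite lee_fin ler_piMr ?expR_ge0//; case/andP: (alive01 s).
rewrite EFinB leeBlDr// -(avg_state_gf s t0 u01 uroot).
apply: le_trans (leeD (lexx _) alive_le).
rewrite -(avgD p_tf) => [|//|j|j]; last 2 first.
- by rewrite lee_fin; case/andP: (extinct_gf01 j).
- by rewrite lee_fin; case/andP: (alive01 j).
apply: (avg_le p_tf) => // j; rewrite /= -EFinD lee_fin -mulrDl -natrD.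
rewrite addnC addn_negb mul1r ler_piMl ?xpow_le1//.
have /andP[? _] := cpow01 j.1.2 y01; have /andP[? _] := cpow01 j.2 z01.
exact: mulr_ge0.
Qed.

End semigroup.
End extinction_gf.

(** * The least root *)

Section least_supersolution.
Variables (R : realType) (R1 R2 : {fset Zp2}) (b : 'I_2 -> Zp2 -> R).
Hypothesis b_rates : offspring_rates b.
Hypothesis death_gt0 : forall a, 0 < - b a (evec a).
Implicit Types (u v : 'rV[R]_2) (y : R1 -> R) (z : R2 -> R).

Let marks01 y z := (forall m, 0 <= y m <= 1) /\ (forall m, 0 <= z m <= 1).

Lemma ler_xpow u v m : unit_square u -> (forall a, u 0 a <= v 0 a) ->
  xpow u m <= xpow v m.
Proof.
move=> u01 uv; apply: ler_prod => a _; have /andP[u0 _] := u01 a.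
by rewrite exprn_ge0// lerXn2r// nnegrE// (le_trans u0).
Qed.

Lemma split_gf_ge0 y z a u : marks01 y z -> unit_square u ->
  (0 <= split_gf b y z a u)%E.
Proof.
move=> [y01 z01] u01; apply: esum_ge0 => m /= me.
have /andP[? _] := mark2_01 a m y01 z01.
by rewrite lee_fin !mulr_ge0 ?(b_ge0 b_rates) ?xpow_ge0.
Qed.

Lemma split_gf_le y z y' z' a u v : marks01 y z -> unit_square u ->
  (forall m, y m <= y' m) -> (forall m, z m <= z' m) ->
  (forall a, u 0 a <= v 0 a) -> (split_gf b y z a u <= split_gf b y' z' a v)%E.
Proof.
move=> [y01 z01] u01 yy' zz' uv; apply: le_esum => m /= me.
have /andP[? _] := mark2_01 a m y01 z01.
rewrite lee_fin ler_wpM2l ?(b_ge0 b_rates)// ler_pM ?xpow_ge0 ?ler_xpow//.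
by rewrite /mark2 /mark; case: ifP => _; case: insub.
Qed.

Lemma split_gf_le_death y z a u : marks01 y z -> unit_square u ->
  (split_gf b y z a u <= (- b a (evec a))%:E)%E.
Proof.
move=> [y01 z01] u01; rewrite -(b_evec b_rates); apply: le_esum => m /= me.
have /andP[? ?] := mark2_01 a m y01 z01.
by rewrite lee_fin ler_piMr ?(b_ge0 b_rates)// mulr_ile1 ?xpow_ge0 ?xpow_le1.
Qed.

Lemma mark2_cst (c : R) a m :
  mark2 (fun _ : R1 => c) (fun _ : R2 => c) a m
  = if m \in (if a == 0 then R1 else R2) then c else 1.
Proof. by rewrite /mark2 /mark; case: ifP => _; case: insubP => [? ->|/negbTE ->]. Qed.

Definition supersolution y z u :=
  unit_square u /\ forall a, (split_gf b y z a u <= (- b a (evec a) * u 0 a)%:E)%E.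

(** The Knaster-Tarski construction: an infimum of supersolutions, taken
    coordinatewise. *)
Definition least_root y z : 'rV[R]_2 :=
  \row_a inf [set u 0 a | u in supersolution y z].

Lemma ones_supersolution y z : marks01 y z -> supersolution y z (ones R).
Proof.
move=> yz01; have ones01 : unit_square (ones R) by move=> a; rewrite mxE ler01 lexx.
by split=> // a; rewrite mxE mulr1 split_gf_le_death.
Qed.

Lemma least_root_le y z u a : supersolution y z u -> least_root y z 0 a <= u 0 a.
Proof.
move=> uS; rewrite mxE; apply: ge_inf; last by exists u.
by exists 0 => _ [v [v01 _] <-]; case/andP: (v01 a).
Qed.

Lemma le_least_root y z c a : marks01 y z ->
  (forall u, supersolution y z u -> c <= u 0 a) -> c <= least_root y z 0 a.
Proof.
move=> yz01 cS; rewrite mxE; apply: lb_le_inf => [|_ [u uS <-]]; last exact: cS.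
by exists (ones R 0 a), (ones R) => //; exact: ones_supersolution.
Qed.

Lemma least_root_supersolution y z : marks01 y z ->
  supersolution y z (least_root y z).
Proof.
move=> yz01; have L01 : unit_square (least_root y z).
  move=> a; rewrite le_least_root// => [|u [u01 _]]; last by case/andP: (u01 a).
  rewrite (le_trans (least_root_le a (ones_supersolution yz01)))//.
  by rewrite mxE.
split=> // a; rewrite mulrC EFinM -lee_pdivrMr//.
rewrite -(@fineK _ (split_gf _ _ _ _ _)); last first.
  by rewrite ge0_fin_numE ?split_gf_ge0// (le_lt_trans (split_gf_le_death a _ L01)) ?ltry.
rewrite -EFinM lee_fin le_least_root// => u uS; rewrite ler_pdivrMr//.
rewrite mulrC -lee_fin fineK; last first.
  by rewrite ge0_fin_numE ?split_gf_ge0// (le_lt_trans (split_gf_le_death a _ L01)) ?ltry.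
case: (uS) => u01 /(_ a); apply: le_trans; apply: split_gf_le => // a'.
exact: least_root_le.
Qed.

(** The map whose fixed points are the roots sends the least supersolution [L] to
    a supersolution [L'] below [L], hence to [L] itself. *)
Lemma least_rootP y z a : marks01 y z ->
  split_gf b y z a (least_root y z) = (- b a (evec a) * least_root y z 0 a)%:E.
Proof.
move=> yz01; set L := least_root y z.
have [L01 LS] := least_root_supersolution yz01.
have fin_gf c : split_gf b y z c L \is a fin_num.
  by rewrite ge0_fin_numE ?split_gf_ge0// (le_lt_trans (split_gf_le_death c _ L01)) ?ltry.
pose L' : 'rV[R]_2 := \row_c (fine (split_gf b y z c L) / - b c (evec c)).
have L'L c : L' 0 c <= L 0 c.
  by rewrite mxE ler_pdivrMr// -lee_fin fineK// mulrC LS.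
have L'01 : unit_square L'.
  move=> c; apply/andP; split; last by apply: le_trans (L'L c) _; case/andP: (L01 c).
  by rewrite mxE divr_ge0 ?(ltW (death_gt0 c))// fine_ge0// split_gf_ge0.
have L'S : supersolution y z L'.
  split=> // c; rewrite mxE mulrCA divff ?gt_eqF// mulr1 fineK//.
  exact: split_gf_le.
apply/eqP; rewrite eq_le LS/= -(fineK (fin_gf a)) lee_fin.
have := least_root_le a L'S; rewrite -/L [in leRHS]mxE ler_pdivlMr//.
by rewrite mulrC.
Qed.

Lemma least_root_le_marks y z y' z' a : marks01 y z -> marks01 y' z' ->
  (forall m, y m <= y' m) -> (forall m, z m <= z' m) ->
  least_root y z 0 a <= least_root y' z' 0 a.
Proof.
move=> yz01 yz01' yy' zz'; apply: least_root_le.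
have [L01 LS] := least_root_supersolution yz01'.
by split=> // c; apply: le_trans (LS c); exact: split_gf_le.
Qed.

(** Letting the marks tend to 1, the limit of the least roots is a
    supersolution of the unmarked equations, hence dominates their least root. *)
Lemma least_root_approx (M : R) a :
  (forall c : R, 0 <= c < 1 ->
     least_root (fun _ => c) (fun _ => c) 0 a <= M) ->
  least_root (fun=> 1) (fun=> 1) 0 a <= M.
Proof.
move=> LM; pose c n : R := 1 - n.+1%:R^-1.
have c01 n : 0 <= c n < 1.
  by rewrite subr_ge0 invf_le1 ?ler1n ?ltr0n//= gtrBl invr_gt0 ltr0n.
have c_marks n : marks01 (fun=> c n) (fun=> c n).
  by have /andP[? /ltW ?] := c01 n; split=> m; apply/andP.
pose L n := least_root (fun=> c n) (fun=> c n).
have L01 n : unit_square (L n) by case: (least_root_supersolution (c_marks n)).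
have c_homo m n : (m <= n)%N -> c m <= c n.
  by move=> mn; rewrite lerD2l lerN2 lef_pV2 ?posrE ?ltr0n// ler_nat ltnS.
have L_nd d : nondecreasing_seq (fun n => L n 0 d).
  by move=> m n mn; apply: least_root_le_marks => // _; exact: c_homo.
have L_cvg d : cvgn (fun n => L n 0 d).
  apply: nondecreasing_is_cvgn => //; exists 1 => _ [n _ <-].
  by case/andP: (L01 n d).
pose l : 'rV[R]_2 := \row_d limn (fun n => L n 0 d).
have Ll d : L n 0 d @[n --> \oo] --> l 0 d by rewrite mxE; exact: L_cvg.
have L_le n d : L n 0 d <= l 0 d.
  by rewrite [leRHS]mxE; exact: (nondecreasing_cvgn_le (L_nd d) (L_cvg d)).
have l01 : unit_square l.
  move=> d; apply/andP; split.
    by apply: le_trans (L_le 0%N d); case/andP: (L01 0%N d).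
  by rewrite mxE; apply: limr_le => //; apply: nearW => n; case/andP: (L01 n d).
apply: (@le_trans _ _ (l 0 a)); last first.
  by rewrite mxE; apply: limr_le => //; apply: nearW => n; exact: LM.
have c_cvg : c n @[n --> \oo] --> (1 : R).
  rewrite -[X in _ --> X]subr0; apply: cvgB; first exact: cvg_cst.
  exact: cvg_harmonic.
apply: least_root_le; split=> // d; apply: esum_le_finite => F Fd.
rewrite sumEFin lee_fin.
have Lx_cvg c' j : L n 0 c' ^+ j @[n --> \oo] --> l 0 c' ^+ j.
  by have := cvg_comp _ _ (Ll c') (@exprn_continuous R j (l 0 c')).
have lhs_cvg (r : seq Zp2) :
    \sum_(m <- r) b d m
      * (mark2 (fun _ : R1 => c n) (fun _ : R2 => c n) d m * xpow (L n) m)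
    @[n --> \oo] --> \sum_(m <- r) b d m
      * (mark2 (fun _ : R1 => 1) (fun _ : R2 => 1) d m * xpow l m).
  elim: r => [|m r IH].
    by rewrite big_nil; under eq_cvg do rewrite big_nil; exact: cvg_cst.
  rewrite big_cons; under eq_cvg do rewrite big_cons.
  apply: cvgD => //; apply: cvgM; first exact: cvg_cst.
  apply: cvgM.
    under eq_cvg do rewrite mark2_cst; rewrite mark2_cst.
    by case: ifP => _; [exact: c_cvg|exact: cvg_cst].
  rewrite /xpow prod2; under eq_cvg do rewrite prod2.
  by apply: cvgM; exact: Lx_cvg.
have rhs_cvg : - b d (evec d) * L n 0 d @[n --> \oo] --> - b d (evec d) * l 0 d.
  by apply: cvgM => //; exact: cvg_cst.
apply: (ler_cvg_to (lhs_cvg F) rhs_cvg).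
apply: nearW => n; rewrite -lee_fin -sumEFin.
have [_ /(_ d)] := least_root_supersolution (c_marks n).
by apply: le_trans; exact: esum_ge_finite.
Qed.

End least_supersolution.

(** * The equations for the roots *)

Section equations.
Variables (R : realType) (R1 R2 : {fset Zp2}) (b : 'I_2 -> Zp2 -> R).
Hypothesis b_rates : offspring_rates b.
Implicit Types (u x : 'rV[R]_2) (y : R1 -> R) (z : R2 -> R).

Lemma xpow_evec x a : xpow x (evec a) = x 0 a.
Proof.
rewrite /xpow (bigD1 a)//= big1 => [|c ca]; rewrite ffunE ?eqxx ?expr1 ?mulr1//.
by rewrite (negbTE ca).
Qed.

(** The only term of the family that may be negative is the one at [evec a]. *)
Lemma usum_rates (D : set Zp2) a x : unit_square x -> D (evec a) ->
  usum D (fun j => b a j * xpow x j)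
  = fine (\esum_(j in D `\` [set evec a]) (b a j * xpow x j)%:E)
    + b a (evec a) * x 0 a.
Proof.
move=> x01 De; have /andP[x0 _] := x01 a.
have DE : D `&` [set evec a] = [set evec a].
  by apply/seteqP; split=> [j []//|j ->].
have be0 : b a (evec a) * x 0 a <= 0.
  by rewrite mulr_le0_ge0// -oppr_ge0 death_ge0.
have bj0 j : j != evec a -> 0 <= b a j * xpow x j.
  by move=> je; rewrite mulr_ge0 ?(b_ge0 b_rates) ?xpow_ge0.
rewrite /usum; congr (_ + _).
  congr fine; rewrite (esumID [set evec a]) => [|j _]; last first.
    by rewrite lee_fin le_max lexx orbT.
  rewrite DE esum_set1 ?xpow_evec; last by rewrite lee_fin le_max lexx orbT.
  rewrite max_r// add0e -setDE; apply: eq_esum => j [_ /= /eqP je].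
  by rewrite max_l// bj0.
rewrite (esumID [set evec a]) => [|j _]; last first.
  by rewrite lee_fin le_max lexx orbT.
rewrite DE esum_set1 ?xpow_evec; last by rewrite lee_fin le_max lexx orbT.
rewrite [X in (_ + X)%E]esum1 ?adde0/=; last first.
  move=> j [_ /= /eqP je]; rewrite max_r// oppr_le0 bj0//.
by rewrite max_l ?opprK// oppr_ge0.
Qed.

Lemma BfunE a x : unit_square x ->
  Bfun (b a) x
  = fine (\esum_(m in [set m | m != evec a]) (b a m * xpow x m)%:E)
    + b a (evec a) * x 0 a.
Proof.
move=> x01; rewrite /Bfun usum_rates//; congr (fine (esum _ _) + _).
by apply/seteqP; split=> [j [_ /= /eqP]|j /= /eqP].
Qed.

Lemma split_gf_unmarked a x :
  split_gf b (fun _ : R1 => 1) (fun _ : R2 => 1) a x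
  = \esum_(m in [set m | m != evec a]) (b a m * xpow x m)%:E.
Proof. by apply: eq_esum => m _; rewrite mark2_cst; case: ifP => _; rewrite mul1r. Qed.

Lemma Bmarked_Bbar (S : {fset Zp2}) (w : S -> R) a x :
  (forall m, 0 <= w m <= 1) -> unit_square x -> evec a \notin S ->
  Bmarked (b a) w x + Bbar (b a) S x
  = fine (\esum_(m in [set m | m != evec a]) (b a m * (mark w m * xpow x m))%:E)
    + b a (evec a) * x 0 a.
Proof.
move=> w01 x01 eS; rewrite /Bbar usum_rates// addrA; congr (_ + _).
have term_ge0 m : m != evec a -> 0 <= b a m * (mark w m * xpow x m).
  move=> me; have /andP[? _] := mark01 m w01.
  by rewrite !mulr_ge0 ?(b_ge0 b_rates) ?xpow_ge0.
have Se : [set` S] `<=` [set m | m != evec a].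
  by move=> m /= mS; apply: contraNneq eS => <-.
rewrite [in RHS](esumD_fset Se) => [|m /= me]; last first.
  by rewrite lee_fin; exact: term_ge0.
rewrite sumEFin [X in fine (_ + X)%E](_ : _ =
    \esum_(j in [set j | j \notin S] `\` [set evec a]) (b a j * xpow x j)%:E); last first.
  rewrite (_ : _ `\` _ = [set j | j \notin S] `\` [set evec a]); last first.
    by apply/seteqP; split=> [j [/= /eqP je /negP jS]|j [/= /negP jS /eqP je]].
  apply: eq_esum => j [/= jS _]; rewrite /mark insubN//.
  by rewrite mul1r.
rewrite fineD//; last first.
  rewrite ge0_fin_numE; last first.
    apply: esum_ge0 => j [_ /= /eqP je].
    by rewrite lee_fin mulr_ge0 ?(b_ge0 b_rates) ?xpow_ge0.
  apply: (@le_lt_trans _ _ (- b a (evec a))%:E); last exact: ltry.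
  rewrite -(b_evec b_rates) [leRHS](esumID [set j | j \notin S]) => [|m /= me]; last first.
    by rewrite lee_fin (b_ge0 b_rates).
  rewrite (_ : _ `&` [set j | j \notin S] = [set j | j \notin S] `\` [set evec a]); last first.
    apply/seteqP; split=> [j [/= /eqP je /negP jS]|j [/= /negP jS /eqP je]].
      by split=> //; apply/negP.
    by split=> //; apply/negP.
  rewrite -[leLHS]adde0 leeD//; last first.
    by apply: esum_ge0 => m [/= me _]; rewrite lee_fin (b_ge0 b_rates).
  apply: le_esum => m [_ /= /eqP me].
  by rewrite lee_fin ler_piMr ?(b_ge0 b_rates) ?xpow_le1.
congr (_ + _); rewrite /= /Bmarked big_seq_fsetE/=; apply: eq_bigr => m _.
by rewrite /mark valK mulrA mulrAC.
Qed.

Hypothesis evec_R1 : evec 0 \notin R1.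
Hypothesis evec_R2 : evec 1 \notin R2.

Lemma split_gf_fin y z a x : (forall m, 0 <= y m <= 1) -> (forall m, 0 <= z m <= 1) ->
  unit_square x -> split_gf b y z a x \is a fin_num.
Proof.
move=> y01 z01 x01; rewrite ge0_fin_numE ?split_gf_ge0//.
by rewrite (le_lt_trans (split_gf_le_death b_rates a _ x01)) ?ltry.
Qed.

Let fine_root (s : \bar R) (c x : R) : s \is a fin_num ->
  (fine s + c * x == 0) = (s == (- c * x)%:E).
Proof. by move=> s_fin; rewrite addr_eq0 -mulNr -eqe fineK. Qed.

Lemma marked_rootP y z u : (forall m, 0 <= y m <= 1) -> (forall m, 0 <= z m <= 1) ->
  unit_square u ->
  (Bmarked (b 0) y u + Bbar (b 0) R1 u = 0 /\
   Bmarked (b 1) z u + Bbar (b 1) R2 u = 0) <->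
  (forall a, split_gf b y z a u = (- b a (evec a) * u 0 a)%:E).
Proof.
move=> y01 z01 u01; rewrite !Bmarked_Bbar//.
have rootE a : (fine (split_gf b y z a u) + b a (evec a) * u 0 a == 0)
  = (split_gf b y z a u == (- b a (evec a) * u 0 a)%:E).
  by apply: fine_root; exact: split_gf_fin.
split=> [[/eqP h0 /eqP h1] a|h].
  by apply/eqP; rewrite -rootE; case: (ord2P a) => ->.
have r a : fine (split_gf b y z a u) + b a (evec a) * u 0 a == 0.
  by rewrite rootE h.
by split; apply/eqP; [exact: (r 0)|exact: (r 1)].
Qed.

Lemma extinction_rootP u : unit_square u ->
  (forall a, Bfun (b a) u = 0) <->
  (forall a, split_gf b (fun _ : R1 => 1) (fun _ : R2 => 1) a u
             = (- b a (evec a) * u 0 a)%:E).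
Proof.
move=> u01.
have rootE a : (Bfun (b a) u == 0)
  = (split_gf b (fun _ : R1 => 1) (fun _ : R2 => 1) a u == (- b a (evec a) * u 0 a)%:E).
  rewrite BfunE// -split_gf_unmarked; apply: fine_root.
  by apply: split_gf_fin => // m; rewrite ler01 lexx.
split=> h a; apply/eqP; first by rewrite -rootE; exact/eqP.
by rewrite rootE; exact/eqP.
Qed.

Hypothesis death_gt0 : forall a, 0 < - b a (evec a).

Lemma qroot_root y z : (forall m, 0 <= y m <= 1) -> (forall m, 0 <= z m <= 1) ->
  unit_square (qroot b y z) /\
  forall a, split_gf b y z a (qroot b y z) = (- b a (evec a) * qroot b y z 0 a)%:E.
Proof.
move=> y01 z01.
have [|q01 q0 q1] := @getPex _ [set u | [/\ unit_square u,
                   Bmarked (b 0) y u + Bbar (b 0) R1 u = 0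
                 & Bmarked (b 1) z u + Bbar (b 1) R2 u = 0]].
  have [L01 _] := least_root_supersolution b_rates death_gt0 (conj y01 z01).
  exists (least_root b y z).
  have [] := (marked_rootP y01 z01 L01).2 => // a.
  exact: least_rootP.
by split=> //; apply/marked_rootP.
Qed.

Lemma qminE a : qmin b 0 a = least_root b (fun _ : R1 => 1) (fun _ : R2 => 1) 0 a.
Proof.
have one01 : (forall m : R1, 0 <= (1 : R) <= 1) /\ (forall m : R2, 0 <= (1 : R) <= 1).
  by split=> m; rewrite ler01 lexx.
have [L01 _] := least_root_supersolution b_rates death_gt0 one01.
set L := least_root _ _ _.
have Lroot : extinction_root b L.
  split=> //; apply/(extinction_rootP L01) => c; exact: least_rootP.
have Lmin v c : extinction_root b v -> L 0 c <= v 0 c.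
  move=> [v01 /(extinction_rootP v01) vE]; apply: least_root_le.
  by split=> // d; rewrite vE.
have [|q_root qmin_le] := @getPex _ [set u | extinction_root b u /\
               forall v, extinction_root b v -> forall k, u 0 k <= v 0 k].
  by exists L; split=> // v vE c; exact: Lmin.
by apply/eqP; rewrite eq_le /qmin qmin_le//= Lmin.
Qed.

End equations.

(** * Partial derivatives at [ones] *)

Section moments.
Variables (R : realType) (b : 'I_2 -> Zp2 -> R).
Hypothesis b_rates : offspring_rates b.

Lemma within_at_left :
  within [set h : R | 0 <= 1 + h <= 1] (0 : R)^' = (0 : R)^'-.
Proof.
apply/seteqP; split=> P; rewrite /at_left /dnbhs /within /= => P0.
  apply: filterS2 (nbhs0_lt ltr01) P0 => h; rewrite ltr_norml => /andP[h1 _] Ph h0.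
  apply: Ph; first by rewrite lt_eqF.
  by apply/andP; split; lra.
apply: filterS P0 => h Ph h0 /andP[_ h1]; apply: Ph.
by rewrite lt_neqAle h0; lra.
Qed.

(** The difference quotient [(1 - (1 - t) ^+ n) / t], without division. *)
Definition geom (n : nat) (t : R) : R := \sum_(k < n) (1 - t) ^+ k.

Lemma expr_geom n t : (1 - t) ^+ n = 1 - t * geom n t.
Proof.
have := subrX1 (1 - t) n; rewrite -/(geom n t) => /eqP.
by rewrite subr_eq => /eqP ->; ring.
Qed.

Lemma geom_ge0 n t : 0 <= t <= 1 -> 0 <= geom n t.
Proof.
by move=> /andP[t0 t1]; rewrite sumr_ge0// => k _; rewrite exprn_ge0 ?subr_ge0.
Qed.

Lemma geom_le n t : 0 <= t <= 1 -> geom n t <= n%:R.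
Proof.
move=> /andP[t0 t1]; rewrite -[n in n%:R]card_ord -sumr_const; apply: ler_sum => k _.
by rewrite exprn_ile1 ?subr_ge0// lerBlDr lerDl.
Qed.

Lemma geom_nonincreasing n s t : 0 <= s -> s <= t -> t <= 1 -> geom n t <= geom n s.
Proof.
move=> s0 st t1; apply: ler_sum => k _; rewrite lerXn2r ?nnegrE ?subr_ge0//.
  exact: le_trans st t1.
by rewrite lerB.
Qed.

Lemma cvg_geom n : geom n t @[t --> (0 : R)^'+] --> (n%:R : R).
Proof.
apply: cvg_at_right_filter.
have pow_cvg k : (1 - t : R) ^+ k @[t --> (0 : R)] --> (1 : R).
  rewrite -[X in _ --> X](expr1n _ k).
  have sub_cvg : (1 - t : R) @[t --> (0 : R)] --> (1 : R).
    by rewrite -[X in _ --> X]subr0; apply: cvgB; [exact: cvg_cst|exact: cvg_id].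
  by have := cvg_comp _ _ sub_cvg (@exprn_continuous R k 1).
elim: n => [|n IH].
  by under eq_cvg do rewrite /geom big_ord0; exact: cvg_cst.
under eq_cvg do rewrite /geom big_ord_recr/=.
by rewrite -natr1; apply: cvgD.
Qed.

Definition mean a l : \bar R :=
  \esum_(m in [set m | m != evec a]) (b a m * (m l)%:R)%:E.

(** Up to the diagonal rate, the difference quotient of [Bfun (b a)] between [ones]
    and the point at distance [t] from it along the coordinate [l]. *)
Definition mean_quot a l (t : R) : \bar R :=
  \esum_(m in [set m | m != evec a]) (b a m * geom (m l) t)%:E.

(** Monotone convergence: the quotients increase as [t] decreases, and each finite
    partial sum is continuous. The limit may be infinite. *)
Lemma cvg_mean_quot a l : mean_quot a l t @[t --> (0 : R)^'+] --> mean a l.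
Proof.
have -> : mean a l = ereal_sup [set mean_quot a l t | t in `]0, 1[ ].
  apply/eqP; rewrite eq_le; apply/andP; split; last first.
    apply: ge_ereal_sup => _ [t /= t01 <-]; move: t01; rewrite in_itv/= => /andP[t0 t1].
    apply: le_esum => m /= me; rewrite lee_fin ler_wpM2l ?(b_ge0 b_rates)//.
    by rewrite geom_le// !ltW.
  apply: esum_le_finite => F Fe; rewrite sumEFin.
  set S := ereal_sup _.
  have F_le t : 0 < t < 1 -> ((\sum_(m <- F) b a m * geom (m l) t)%:E <= S)%E.
    move=> t01; apply: (@le_trans _ _ (mean_quot a l t)).
      by rewrite -sumEFin; exact: esum_ge_finite.
    by apply: ereal_sup_ubound; exists t => //=; rewrite in_itv.
  have lhs_cvg (r : seq Zp2) : \sum_(m <- r) b a m * geom (m l) t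
      @[t --> (0 : R)^'+] --> \sum_(m <- r) b a m * (m l)%:R.
    elim: r => [|m r IH].
      by rewrite big_nil; under eq_cvg do rewrite big_nil; exact: cvg_cst.
    rewrite big_cons; under eq_cvg do rewrite big_cons.
    by apply: cvgD => //; apply: cvgM; [exact: cvg_cst|exact: cvg_geom].
  have near01 : \forall t \near (0 : R)^'+, 0 < t < 1.
    by apply: filterS2 (nbhs_right_gt 0) (nbhs_right_lt ltr01) => t -> ->.
  clearbody S; case: S F_le => [r| |] F_le.
  - rewrite lee_fin; apply: (ler_cvg_to (lhs_cvg F) (cvg_cst r)).
    by apply: filterS near01 => t /F_le; rewrite lee_fin.
  - by rewrite leey.
  - have /F_le : 0 < (2^-1 : R) < 1 by rewrite invr_gt0 ltr0n/= invf_lt1 ?ltr1n ?ltr0n.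
    by rewrite leeNy_eq.
apply: (@nonincreasing_at_right_cvge _ _ _ (BLeft 1)); first by rewrite bnd_simp.
move=> s t; rewrite !in_itv/= => /andP[s0 s1] /andP[t0 t1] st.
apply: le_esum => m /= me; rewrite lee_fin ler_wpM2l ?(b_ge0 b_rates)//.
by rewrite geom_nonincreasing// ltW.
Qed.

Lemma mean_quot_split a l t : 0 < t <= 1 ->
  ((- b a (evec a))%:E
  = \esum_(m in [set m | m != evec a]) (b a m * (1 - t) ^+ m l)%:E
    + t%:E * mean_quot a l t)%E.
Proof.
move=> /andP[t0 t1]; have t01 : 0 <= t <= 1 by rewrite ltW.
have b_norm m : m != evec a -> `|b a m| = b a m.
  by move=> me; rewrite ger0_norm// (b_ge0 b_rates).
have -> : mean_quot a l t
    = \esum_(m in [set m | m != evec a]) (`|b a m| * geom (m l) t)%:E.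
  by apply: eq_esum => m /= me; rewrite b_norm.
rewrite -esumZl ?(ltW t0)// => [|m]; last by rewrite lee_fin mulr_ge0 ?geom_ge0.
rewrite -(b_evec b_rates) -esumD => [|m /= me|m /= me]; last 2 first.
- by rewrite lee_fin mulr_ge0 ?(b_ge0 b_rates)// exprn_ge0 ?subr_ge0.
- by rewrite -EFinM lee_fin mulr_ge0 ?(ltW t0)// mulr_ge0 ?geom_ge0.
apply: eq_esum => m /= me; rewrite -EFinM -EFinD b_norm// expr_geom.
by congr EFin; ring.
Qed.

Lemma mean_quot_fin a l t : 0 < t <= 1 -> mean_quot a l t \is a fin_num.
Proof.
move=> t01; have /andP[t0 t1] := t01.
have tq_fin : (t%:E * mean_quot a l t)%E \is a fin_num.
  have q0 : (0 <= t%:E * mean_quot a l t)%E.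
    rewrite mule_ge0 ?lee_fin ?(ltW t0)//; apply: esum_ge0 => m /= me.
    by rewrite lee_fin mulr_ge0 ?(b_ge0 b_rates) ?geom_ge0// (ltW t0).
  rewrite ge0_fin_numE//; apply: le_lt_trans (ltry (- b a (evec a))).
  rewrite (mean_quot_split a l t01) leeDr//; apply: esum_ge0 => m /= me.
  by rewrite lee_fin mulr_ge0 ?(b_ge0 b_rates)// exprn_ge0 ?subr_ge0.
rewrite -[mean_quot a l t]mul1e -(divff (lt0r_neq0 t0)) mulrC EFinM -muleA.
exact: fin_numM.
Qed.

Lemma Bfun_ones a : Bfun (b a) (ones R) = 0.
Proof.
have ones01 : unit_square (ones R) by move=> c; rewrite mxE ler01 lexx.
rewrite (BfunE b_rates)// mxE mulr1.
rewrite (@eq_esum _ _ _ _ (fun m => (b a m)%:E)) => [|m _]; last first.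
  by rewrite /xpow big1 ?mulr1// => c _; rewrite mxE expr1n.
by rewrite (b_evec b_rates)/= addNr.
Qed.

Lemma BpartialE a l : Bpartial (b a) l (ones R)
  = (mean a l + (b a (evec a) * (a == l)%:R)%:E)%E.
Proof.
rewrite /Bpartial mxE within_at_left.
apply: cvg_lim; first exact: ereal_hausdorff.
apply/cvg_at_leftNP; rewrite oppr0.
apply: (@cvg_trans _ ((mean_quot a l t + (b a (evec a) * (a == l)%:R)%:E)%E
    @[t --> (0 : R)^'+])); last first.
  apply: cvgeD; [exact: fin_num_adde_defl|exact: cvg_mean_quot|exact: cvg_cst].
apply: near_eq_cvg.
apply: filterS2 (nbhs_right_gt (0 : R)) (nbhs_right_lt (@ltr01 R)) => t t0 t1.
have t01 : 0 < t <= 1 by rewrite t0 ltW.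
set x := ones R + - t *: delta_mx 0 l.
have xE c : x 0 c = 1 - t * (c == l)%:R by rewrite !mxE eqxx/= mulNr.
have x01 : unit_square x.
  by move=> c; rewrite xE; case: (c == l); rewrite ?mulr1 ?mulr0; apply/andP; split; lra.
have xpowE m : xpow x m = (1 - t) ^+ m l.
  rewrite /xpow (bigD1 l)//= big1 ?mulr1 => [|c cl]; rewrite xE ?eqxx ?mulr1//.
  by rewrite (negbTE cl) mulr0 subr0 expr1n.
have := mean_quot_split a l t01.
rewrite /= -/x Bfun_ones subr0 (BfunE b_rates)// xE.
rewrite (@eq_esum _ _ _ _ (fun m => (b a m * (1 - t) ^+ m l)%:E)); last first.
  by move=> m _; rewrite xpowE.
rewrite -[mean_quot a l t](fineK (mean_quot_fin a l t01)).
set E := \esum_(m in _) _ => lE.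
have E_fin : E \is a fin_num.
  have : (E + t%:E * (fine (mean_quot a l t))%:E)%E \is a fin_num by rewrite -lE.
  by rewrite fin_numD => /andP[].
move: lE; rewrite -(fineK E_fin) -EFinM -EFinD => -[lE] /=.
rewrite -EFinD; congr EFin.
have -> : fine E = - b a (evec a) - t * fine (mean_quot a l t).
  by rewrite lE addrK.
by field; rewrite gt_eqF.
Qed.

End moments.

(** * Matrices of order 2 *)

Section two_by_two.
Variable R : realType.
Implicit Types A B : 'M[R]_2.

Lemma mul2E A B i j : i != j -> (A * B) i j = A i i * B i j + A i j * B j j.
Proof.
move=> ij; rewrite -mulmxE mxE sum2.
by case: (ord2P i) (ord2P j) ij => -> [] -> //= _; rewrite addrC.
Qed.

(** Triangular matrices are closed under products and inverses. *)
Lemma offdiag_expz_eq0 A i j (m : int) : i != j -> A i j = 0 -> (A ^ m) i j = 0.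
Proof.
move=> ij Aij; have powA n : (A ^+ n) i j = 0.
  elim: n => [|n IH]; first by rewrite expr0 mxE (negbTE ij).
  by rewrite exprS mul2E// IH Aij mulr0 mul0r addr0.
case: m => n; first exact: powA.
change ((A ^- n.+1) i j = 0).
set X := A ^+ n.+1; have Xij : X i j = 0 by exact: powA.
have [Xu|Xnu] := boolP (X \is a GRing.unit); last by rewrite invr_out.
have XXV : (X * X^-1) i j = 0 by rewrite divrr// mxE (negbTE ij).
have XXV1 : (X * X^-1) i i = 1 by rewrite divrr// mxE eqxx.
have Xii : X i i != 0.
  apply/eqP => Xii0; move: XXV1; rewrite -mulmxE mxE sum2.
  have := Xij; have := Xii0; case: (ord2P i) (ord2P j) ij => -> [] -> //= _ -> ->;
    by rewrite !mul0r addr0 => /eqP; rewrite eq_sym oner_eq0.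
move: XXV; rewrite mul2E// Xij mul0r addr0 => /eqP.
by rewrite mulf_eq0 (negbTE Xii)/= => /eqP.
Qed.

(** The larger root [r] of the characteristic polynomial exceeds both diagonal
    entries, so that the left eigenvector with coordinates [A 1 0] and [r - A 0 0]
    is positive. *)
Lemma perron2 A : 0 < A 0 1 -> 0 < A 1 0 ->
  exists r (v : 'I_2 -> R), [/\ forall c, 0 < v c,
    forall l, v 0 * A 0 l + v 1 * A 1 l = r * v l
    & r <= sup [set a | eigenvalue A a]].
Proof.
move=> A01 A10; set a := A 0 0; set d := A 1 1.
pose D := Num.sqrt ((a - d) ^+ 2 + 4 * (A 0 1 * A 1 0)).
have bc0 : 0 < A 0 1 * A 1 0 by rewrite mulr_gt0.
have D2 : D ^+ 2 = (a - d) ^+ 2 + 4 * (A 0 1 * A 1 0).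
  by rewrite sqr_sqrtr// addr_ge0 ?sqr_ge0// mulr_ge0// ltW.
have D0 : 0 <= D by exact: sqrtr_ge0.
pose r := (a + d + D) / 2.
have ra : a < r.
  rewrite /r ltr_pdivlMr ?ltr0n//; nra.
have rd : d < r.
  rewrite /r ltr_pdivlMr ?ltr0n//; nra.
have rE : (r - a) * (r - d) = A 0 1 * A 1 0.
  have -> : (r - a) * (r - d) = (D ^+ 2 - (a - d) ^+ 2) / 4 by rewrite /r; field.
  by rewrite D2; field.
pose v (c : 'I_2) := if c == 0 then A 1 0 else r - a.
have vE l : v 0 * A 0 l + v 1 * A 1 l = r * v l.
  case: (ord2P l) => ->; rewrite /v /= -/a -/d; first by ring.
  by rewrite mulrC -rE; ring.
exists r, v; split=> // [c|].
  by rewrite /v; case: ifP => // _; rewrite subr_gt0.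
apply: ub_le_sup.
  exists r => s /eigenvalueP[w ws w0]; rewrite leNgt; apply/negP => rs.
  have w0E := congr1 (fun M : 'rV_2 => M 0 0) ws.
  have w1E := congr1 (fun M : 'rV_2 => M 0 1) ws.
  move: w0E w1E; rewrite !mxE !sum2 -/a -/d => w0E w1E.
  have : w 0 0 * ((s - a) * (s - d) - A 0 1 * A 1 0) = 0.
    have w0E' : w 0 1 * A 1 0 = (s - a) * w 0 0 by rewrite mulrBl -w0E; ring.
    have w1E' : w 0 0 * A 0 1 = (s - d) * w 0 1 by rewrite mulrBl -w1E; ring.
    have -> : w 0 0 * ((s - a) * (s - d) - A 0 1 * A 1 0)
      = (s - a) * w 0 0 * (s - d) - w 0 0 * A 0 1 * A 1 0 by ring.
    by rewrite w1E' -w0E'; ring.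
  move/eqP; rewrite mulf_eq0 => /orP[/eqP w00|/eqP].
    move: w0E; rewrite w00 mul0r mulr0 add0r => /eqP.
    rewrite mulf_eq0 (gt_eqF A10) orbF => /eqP w01.
    by case/eqP: w0; apply/rowP => c; rewrite mxE; case: (ord2P c) => ->.
  rewrite -rE; nra.
apply/eigenvalueP; exists (\row_c v c).
  by apply/rowP => l; rewrite !mxE sum2 !mxE vE.
apply/eqP => /rowP/(_ 0); rewrite !mxE /v eqxx => v0.
by rewrite v0 ltxx in A10.
Qed.

End two_by_two.

(** * The case of a nonpositive maximal eigenvalue *)

Section bernoulli_inequality.
Variable R : realType.

Lemma bernoulli (n : nat) (w : R) : 0 <= w <= 1 -> 1 - n%:R * w <= (1 - w) ^+ n.
Proof.
move=> /andP[w0 w1]; elim: n => [|n IH]; first by rewrite mul0r subr0 expr0.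
have w'0 : 0 <= 1 - w by rewrite subr_ge0.
rewrite exprS; apply: le_trans (ler_wpM2l w'0 IH).
have : 0 <= n%:R * w ^+ 2 by rewrite mulr_ge0 ?sqr_ge0.
rewrite -natr1; lra.
Qed.

Lemma bernoulli_lt (n : nat) (w : R) : 0 < w <= 1 ->
  1 - n.+2%:R * w < (1 - w) ^+ n.+2.
Proof.
move=> /andP[w0 w1]; have w'0 : 0 <= 1 - w by rewrite subr_ge0.
have wb : 0 <= w <= 1 by rewrite ltW.
rewrite exprS; apply: lt_le_trans (ler_wpM2l w'0 (bernoulli n.+1 wb)).
have : 0 < n.+1%:R * w ^+ 2 by rewrite mulr_gt0 ?exprn_gt0.
rewrite -[n.+2%:R]natr1; lra.
Qed.

(** The distance from the monomial [xpow u m] to its tangent at [ones]. *)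
Definition excess (u : 'rV[R]_2) (m : Zp2) : R :=
  xpow u m + (m 0)%:R * (1 - u 0 0) + (m 1)%:R * (1 - u 0 1) - 1.

Lemma excess_ge0 u m : unit_square u -> 0 <= excess u m.
Proof.
move=> u01; have /andP[u00 u01'] := u01 0; have /andP[u10 u11] := u01 1.
have b0 := @bernoulli (m 0) (1 - u 0 0); have b1 := @bernoulli (m 1) (1 - u 0 1).
rewrite !subKr in b0 b1.
have {}b0 := b0 _; have {}b1 := b1 _.
rewrite /excess /xpow prod2.
have p1 : u 0 0 ^+ m 0 <= 1 by rewrite exprn_ile1.
have q1 : u 0 1 ^+ m 1 <= 1 by rewrite exprn_ile1.
have h0 : 1 - (m 0)%:R * (1 - u 0 0) <= u 0 0 ^+ m 0.
  by apply: b0; apply/andP; split; lra.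
have h1 : 1 - (m 1)%:R * (1 - u 0 1) <= u 0 1 ^+ m 1.
  by apply: b1; apply/andP; split; lra.
have : 0 <= (1 - u 0 0 ^+ m 0) * (1 - u 0 1 ^+ m 1) by rewrite mulr_ge0 ?subr_ge0.
lra.
Qed.

Lemma excess_gt0 u m : unit_square u -> u 0 0 < 1 -> u 0 1 < 1 ->
  (1 < total m)%N -> 0 < excess u m.
Proof.
move=> u01 u0 u1; have /andP[u00 _] := u01 0; have /andP[u10 _] := u01 1.
rewrite /excess /xpow prod2 /total.
have w01 c : 0 <= 1 - u 0 c <= 1.
  by have /andP[? ?] := u01 c; apply/andP; split; lra.
have b0 n : 1 - n%:R * (1 - u 0 0) <= u 0 0 ^+ n.
  by have := bernoulli n (w01 0); rewrite subKr.
have b1 n : 1 - n%:R * (1 - u 0 1) <= u 0 1 ^+ n.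
  by have := bernoulli n (w01 1); rewrite subKr.
have b0' n : 1 - n.+2%:R * (1 - u 0 0) < u 0 0 ^+ n.+2.
  by have := @bernoulli_lt n (1 - u 0 0); rewrite subKr; apply; apply/andP; split; lra.
have b1' n : 1 - n.+2%:R * (1 - u 0 1) < u 0 1 ^+ n.+2.
  by have := @bernoulli_lt n (1 - u 0 1); rewrite subKr; apply; apply/andP; split; lra.
have pq i j : 0 <= (1 - u 0 0 ^+ i) * (1 - u 0 1 ^+ j).
  by rewrite mulr_ge0// subr_ge0 exprn_ile1// ltW.
case: (m 0) => [|[|i]].
- case: (m 1) => [|[|j]]// _; have := b1' j; have := pq 0%N j.+2.
  rewrite !expr0; lra.
- case: (m 1) => [|j] // _; case: j => [|j].
    have : 0 < (1 - u 0 0) * (1 - u 0 1) by rewrite mulr_gt0 ?subr_gt0.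
    rewrite !expr1; lra.
  have := b1' j; have := pq 1%N j.+2; rewrite !expr1; lra.
- move=> _; have := b0' i; have := b1 (m 1); have := pq i.+2 (m 1); lra.
Qed.

End bernoulli_inequality.

Section criticality.
Variables (R : realType) (b : 'I_2 -> Zp2 -> R).
Hypothesis b_rates : offspring_rates b.
Hypothesis b_A2 : assumption_A2 b.

Lemma mean_ge0 a l : (0 <= mean b a l)%E.
Proof. by apply: esum_ge0 => m /= me; rewrite lee_fin mulr_ge0 ?(b_ge0 b_rates). Qed.

Lemma mean_fin a l : mean b a l \is a fin_num.
Proof.
rewrite ge0_fin_numE ?mean_ge0//; have := b_A2 a l.
by rewrite BpartialE//; case: (mean b a l) => [r _|/=|_] //; rewrite ltry.
Qed.

Lemma BmatrixE a l : Bmatrix b a l = fine (mean b a l) + b a (evec a) * (a == l)%:R.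
Proof. by rewrite mxE BpartialE// fineD// mean_fin. Qed.

Lemma esum_total a :
  \esum_(m in [set m | m != evec a]) (b a m * (total m)%:R)%:E
  = (mean b a 0%R + mean b a 1%R)%E.
Proof.
rewrite /mean -esumD => [|m /= me|m /= me]; last 2 first.
- by rewrite lee_fin mulr_ge0 ?(b_ge0 b_rates).
- by rewrite lee_fin mulr_ge0 ?(b_ge0 b_rates).
by apply: eq_esum => m _; rewrite -EFinD -mulrDr -natrD.
Qed.

Lemma esum_eq0 (D : set Zp2) (f : Zp2 -> R) :
  (forall m, D m -> 0 <= f m) -> \esum_(m in D) (f m)%:E = 0%E ->
  forall m, D m -> f m = 0.
Proof.
move=> f0 sum0 m Dm; apply/eqP; rewrite eq_le f0// andbT.
have FD : [set` [fset m]%fset] `<=` D by move=> j /= /fset1P ->.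
have := @esum_ge_finite R _ D (fun i => (f i)%:E) _ FD.
by rewrite sum0 big_seq_fset1 lee_fin.
Qed.

(** The convexity gap at [u], [Bfun (b a)] being compared with its tangent at
    [ones]; at a root only the tangent is left. *)
Lemma esum_excess u a : unit_square u ->
  \esum_(m in [set m | m != evec a]) (b a m * xpow u m)%:E
    = (- b a (evec a) * u 0 a)%:E ->
  \esum_(m in [set m | m != evec a]) (b a m * excess u m)%:E
  = (Bmatrix b a 0 * (1 - u 0 0) + Bmatrix b a 1 * (1 - u 0 1))%:E.
Proof.
move=> u01 uroot.
have w0 c : 0 <= 1 - u 0 c by have /andP[? ?] := u01 c; rewrite subr_ge0.
have meanZ l : \esum_(m in [set m | m != evec a]) (b a m * ((m l)%:R * (1 - u 0 l)))%:E
    = ((1 - u 0 l) * fine (mean b a l))%:E.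
  rewrite EFinM fineK ?mean_fin//.
  transitivity (\esum_(m in [set m | m != evec a])
      ((1 - u 0 l)%:E * (`|b a m| * (m l)%:R)%:E)%E).
    apply: eq_esum => m /= me; rewrite -EFinM ger0_norm ?(b_ge0 b_rates)//.
    by congr EFin; ring.
  rewrite esumZl//.
  congr (_ * _)%E; apply: eq_esum => m /= me.
  by rewrite ger0_norm ?(b_ge0 b_rates).
have excess_sum : (\esum_(m in [set m | m != evec a]) (b a m * excess u m)%:E
    + (- b a (evec a))%:E
  = (- b a (evec a) * u 0 a)%:E + (((1 - u 0 0) * fine (mean b a 0%R))%:E
    + ((1 - u 0 1) * fine (mean b a 1%R))%:E))%E.
  have gap0 m : m != evec a -> (0 <= (b a m * excess u m)%:E)%E.
    by move=> me; rewrite lee_fin mulr_ge0 ?(b_ge0 b_rates) ?excess_ge0.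
  have pow0 m : m != evec a -> (0 <= (b a m * xpow u m)%:E)%E.
    by move=> me; rewrite lee_fin mulr_ge0 ?(b_ge0 b_rates) ?xpow_ge0.
  have lin0 l m : m != evec a -> (0 <= (b a m * ((m l)%:R * (1 - u 0 l)))%:E)%E.
    by move=> me; rewrite lee_fin mulr_ge0 ?(b_ge0 b_rates) ?mulr_ge0.
  rewrite -uroot -!meanZ -(b_evec b_rates).
  rewrite -[LHS]esumD//; last by move=> m me; rewrite lee_fin (b_ge0 b_rates).
  rewrite -[X in (_ + X)%E]esumD; [|exact: lin0..].
  rewrite -[RHS]esumD//; last by move=> m me; rewrite adde_ge0 ?lin0.
  apply: eq_esum => m _; rewrite -!EFinD /excess; congr EFin; ring.
move: excess_sum; set X := \esum_(m in _) _; rewrite -!EFinD => sumE.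
have X_fin : X \is a fin_num.
  have : (X + (- b a (evec a))%:E)%E \is a fin_num by rewrite sumE.
  by rewrite fin_numD => /andP[].
move: sumE; rewrite -(fineK X_fin) -EFinD => -[sumE]; congr EFin.
rewrite !BmatrixE.
by case: (ord2P a) sumE => -> sumE; rewrite ?eqxx /= ?mulr1 ?mulr0; lra.
Qed.

(** Let [A] be the matrix of the derivatives at [ones], [w] the vector of the
    [1 - u 0 c], and [v] a positive left eigenvector of [A] for an eigenvalue
    [r <= 0]. By convexity [A w] is nonnegative, while its pairing with [v] is
    [r] times a nonnegative number, so [A w] vanishes. If [w] were not 0 then both
    its coordinates would be positive, as the off-diagonal entries of [A] are;
    then [r] and all the convexity gaps vanish, no individual has two children or
    more, and applying [v] to [A] once more shows that none dies childless: [B] is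
    linear on the square. *)
Lemma subcritical_root (u : 'rV[R]_2) :
  assumption_A1 b -> assumption_A3 b -> rho1 b <= 0 -> unit_square u ->
  (forall a, \esum_(m in [set m | m != evec a]) (b a m * xpow u m)%:E
             = (- b a (evec a) * u 0 a)%:E) ->
  forall a, u 0 a = 1.
Proof.
move=> b_A1 [n b_A3] rho0 u01 uroot.
set A := Bmatrix b in b_A3.
have A_ge0 i l : i != l -> 0 <= A i l.
  by move=> /negbTE il; rewrite BmatrixE il mulr0 addr0 fine_ge0 ?mean_ge0.
have A_gt0 i l : i != l -> 0 < A i l.
  move=> il; rewrite lt_neqAle A_ge0// andbT eq_sym; apply/eqP => A0.
  by have := b_A3 i l; rewrite offdiag_expz_eq0// ltxx.
have A01 : 0 < A 0 1 by exact: A_gt0.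
have A10 : 0 < A 1 0 by exact: A_gt0.
have [r [v [v_gt0 vE r_le]]] := perron2 A01 A10.
have r0 : r <= 0 by exact: le_trans r_le rho0.
pose w c := 1 - u 0 c.
have w_ge0 c : 0 <= w c by have /andP[? ?] := u01 c; rewrite subr_ge0.
pose gap a := A a 0 * w 0 + A a 1 * w 1.
have gapE a : \esum_(m in [set m | m != evec a]) (b a m * excess u m)%:E = (gap a)%:E.
  by rewrite esum_excess.
have gap_ge0 a : 0 <= gap a.
  rewrite -lee_fin -gapE; apply: esum_ge0 => m /= me.
  by rewrite lee_fin mulr_ge0 ?(b_ge0 b_rates) ?excess_ge0.
have vgap : v 0 * gap 0 + v 1 * gap 1 = r * (v 0 * w 0 + v 1 * w 1).
  transitivity ((v 0 * A 0 0 + v 1 * A 1 0) * w 0 + (v 0 * A 0 1 + v 1 * A 1 1) * w 1).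
    by rewrite /gap; ring.
  by rewrite !vE; ring.
have v0 := v_gt0 0; have v1 := v_gt0 1.
have vw_ge0 : 0 <= v 0 * w 0 + v 1 * w 1 by rewrite addr_ge0// mulr_ge0// ltW.
have gap0 a : gap a = 0.
  have : v 0 * gap 0 + v 1 * gap 1 <= 0 by rewrite vgap mulr_le0_ge0.
  have g0 := gap_ge0 0; have g1 := gap_ge0 1.
  have vg0 : 0 <= v 0 * gap 0 by rewrite mulr_ge0// ltW.
  have vg1 : 0 <= v 1 * gap 1 by rewrite mulr_ge0// ltW.
  move=> vg; apply/eqP; case: (ord2P a) => ->.
    rewrite -(mulrI_eq0 _ (lregP (lt0r_neq0 v0))); apply/eqP; lra.
  rewrite -(mulrI_eq0 _ (lregP (lt0r_neq0 v1))); apply/eqP; lra.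
have [w_eq0|w_neq0] := eqVneq (w 0 + w 1) 0.
  move=> a; have w00 := w_ge0 0; have w10 := w_ge0 1.
  by case: (ord2P a) => ->; move: w_eq0 w00 w10; rewrite /w; lra.
have w0_gt0 : 0 < w 0.
  rewrite lt_neqAle w_ge0 andbT eq_sym; apply/eqP => w00.
  have := gap0 0; rewrite /gap w00 mulr0 add0r => /eqP.
  rewrite mulf_eq0 (gt_eqF A01)/= => /eqP w10.
  by rewrite w00 w10 addr0 eqxx in w_neq0.
have w1_gt0 : 0 < w 1.
  rewrite lt_neqAle w_ge0 andbT eq_sym; apply/eqP => w10.
  have := gap0 1; rewrite /gap w10 mulr0 addr0 => /eqP.
  rewrite mulf_eq0 (gt_eqF A10)/= => /eqP w00.
  by rewrite w00 w10 addr0 eqxx in w_neq0.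
have r_eq0 : r = 0.
  have : r * (v 0 * w 0 + v 1 * w 1) = 0 by rewrite -vgap !gap0 !mulr0 addr0.
  by move/eqP; rewrite mulf_eq0 [X in _ || X]gt_eqF ?orbF ?addr_gt0 ?mulr_gt0// => /eqP.
(* so no individual has two children or more *)
have total_le1 a m : m != evec a -> b a m != 0 -> (total m <= 1)%N.
  move=> me; apply: contraR; rewrite -ltnNge => m2.
  have e_gt0 : 0 < excess u m by apply: excess_gt0 => //; rewrite -subr_gt0.
  have /eqP : b a m * excess u m = 0.
    apply: (esum_eq0 _ (etrans (gapE a) (congr1 EFin (gap0 a))) me) => j /= je.
    by rewrite mulr_ge0 ?(b_ge0 b_rates) ?excess_ge0.
  by rewrite mulf_eq0 (gt_eqF e_gt0) orbF.
have total_fin a : \esum_(m in [set m | m != evec a]) (b a m * (total m)%:R)%:E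
    = (A a 0 + A a 1 - b a (evec a))%:E.
  rewrite esum_total -(fineK (mean_fin a 0)) -(fineK (mean_fin a 1)) -EFinD.
  by rewrite !BmatrixE; congr EFin; case: (ord2P a) => ->; rewrite ?eqxx /=; ring.
have total_ge0 a m : m != evec a -> 0 <= b a m * (1 - (total m)%:R).
  move=> me; have [->|b0] := eqVneq (b a m) 0; first by rewrite mul0r.
  by rewrite mulr_ge0 ?(b_ge0 b_rates)// subr_ge0 lern1 (total_le1 a).
have rest_sum a : (\esum_(m in [set m | m != evec a]) (b a m * (1 - (total m)%:R))%:E
    + (A a 0 + A a 1 - b a (evec a))%:E = (- b a (evec a))%:E)%E.
  rewrite -total_fin -(b_evec b_rates) -esumD => [|m /= me|m /= me]; last 2 first.
  - by rewrite lee_fin total_ge0.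
  - by rewrite lee_fin mulr_ge0 ?(b_ge0 b_rates).
  by apply: eq_esum => m _; rewrite -EFinD -mulrDr subrK mulr1.
have rest_ge0 a :
    (0 <= \esum_(m in [set m | m != evec a]) (b a m * (1 - (total m)%:R))%:E)%E.
  by apply: esum_ge0 => m /= me; rewrite lee_fin total_ge0.
have A_row_le0 a : A a 0 + A a 1 <= 0.
  rewrite -(lerD2r (- b a (evec a))) add0r -lee_fin -(rest_sum a) leeDr//.
have A_row0 a : A a 0 + A a 1 = 0.
  have := vE 0; have := vE 1; rewrite r_eq0 !mul0r => vA1 vA0.
  have g0 := A_row_le0 0; have g1 := A_row_le0 1.
  have vg0 : v 0 * (A 0 0 + A 0 1) <= 0 by rewrite mulr_ge0_le0// ltW.
  have vg1 : v 1 * (A 1 0 + A 1 1) <= 0 by rewrite mulr_ge0_le0// ltW.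
  apply/eqP; case: (ord2P a) => ->.
    rewrite -(mulrI_eq0 _ (lregP (lt0r_neq0 v0))); apply/eqP; lra.
  rewrite -(mulrI_eq0 _ (lregP (lt0r_neq0 v1))); apply/eqP; lra.
have rest0 a : \esum_(m in [set m | m != evec a]) (b a m * (1 - (total m)%:R))%:E = 0%E.
  apply/eqP; rewrite eq_le rest_ge0 andbT.
  rewrite -(@leeD2rE _ (- b a (evec a))%:E)// add0e.
  by have := rest_sum a; rewrite A_row0 add0r => ->.
have total1 a m : m != evec a -> b a m != 0 -> total m = 1%N.
  move=> me bm; have /eqP := esum_eq0 (@total_ge0 a) (rest0 a) me.
  by rewrite mulf_eq0 (negbTE bm) subr_eq0 eq_sym pnatr_eq1 => /eqP.
(* hence B is linear on the square, which is excluded *)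
case: b_A1; exists A^T => x x01; apply/rowP => a.
have trE c : A^T c a = A a c by rewrite mxE.
rewrite [LHS]mxE [RHS]mxE sum2 !trE (BfunE b_rates)//.
have x_ge0 c : 0 <= x 0 c by case/andP: (x01 c).
have -> : \esum_(m in [set m | m != evec a]) (b a m * xpow x m)%:E
    = (x 0 0 * fine (mean b a 0) + x 0 1 * fine (mean b a 1))%:E.
  have meanZ l : \esum_(m in [set m | m != evec a])
      ((x 0 l)%:E * (`|b a m| * (m l)%:R)%:E)%E = (x 0 l * fine (mean b a l))%:E.
    rewrite esumZl// EFinM fineK ?mean_fin//; congr (_ * _)%E.
    by apply: eq_esum => m /= me; rewrite ger0_norm ?(b_ge0 b_rates).
  rewrite EFinD -!meanZ -esumD; last 2 first.
  - by move=> m _; rewrite -EFinM lee_fin !mulr_ge0.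
  - by move=> m _; rewrite -EFinM lee_fin !mulr_ge0.
  apply: eq_esum => m /= me; rewrite ger0_norm ?(b_ge0 b_rates)// -!EFinM -EFinD.
  congr EFin; have [->|bm] := eqVneq (b a m) 0; first by rewrite !mul0r !mulr0 addr0.
  have := total1 a m me bm; rewrite /total /xpow prod2.
  by case: (m 0) (m 1) => [|[|i]] [|[|j]]// _; rewrite ?expr0 ?expr1; ring.
by rewrite /A !BmatrixE; case: (ord2P a) => ->; rewrite ?eqxx /=; ring.
Qed.

End criticality.

(** * Paths *)

Section integral_off_null.
Local Open Scope ereal_scope.
Context d (Omega : measurableType d) (R : realType).
Variable mu : {measure set Omega -> \bar R}.

Import HBNNSimple.

(** The value of the chain at a hitting time is controlled off a null set only.
    This determines its integral, whether or not it is measurable: the integral of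
    a nonnegative function is a supremum over the simple functions below it. *)
Lemma integral_off_null (f g : Omega -> \bar R) (N : set Omega) :
  measurable N -> mu N = 0 -> measurable_fun setT g ->
  (forall x, 0 <= f x) -> (forall x, ~ N x -> f x = g x) ->
  (forall x, N x -> g x = 0) ->
  \int[mu]_x f x = \int[mu]_x g x.
Proof.
move=> mN N0 mg f0 fg gN.
have g0 x : 0 <= g x by have [/gN ->//|Nx] := pselect (N x); rewrite -fg.
have gf x : g x <= f x by have [/gN ->//|Nx] := pselect (N x); rewrite -fg.
apply/eqP; rewrite eq_le; apply/andP; split; last first.
  rewrite !ge0_integralTE//; apply: ge_ereal_sup => _ [h hg <-].
  by apply: ereal_sup_ubound; exists h => // x; exact: le_trans (hg x) (gf x).
rewrite [leLHS]ge0_integralTE//; apply: ge_ereal_sup => _ [h /= hf <-].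
have mh : measurable_fun setT (EFin \o h) by exact/measurable_EFinP.
have h0 x : 0 <= (h x)%:E by rewrite lee_fin.
rewrite -integralT_nnsfun (ge0_negligible_integral mN)//.
apply: (@le_trans _ _ (\int[mu]_(x in setT `\` N) g x)).
  apply: ge0_le_integral => //; first exact: measurableD.
  - exact: measurable_funTS.
  - exact: measurable_funTS.
  - by move=> x [_ Nx]; rewrite -fg.
by apply: ge0_subset_integral => //; exact: measurableD.
Qed.

Lemma negligible_countable (I : countType) (F : I -> set Omega) :
  (forall i, mu.-negligible (F i)) -> mu.-negligible (\bigcup_i F i).
Proof.
move=> F0; have sub : \bigcup_i F i
    `<=` \bigcup_n (if choice.unpickle n is Some i then F i else set0).
  by move=> w [i _ Fw]; exists (choice.pickle i) => //; rewrite choice.pickleK.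
apply: (negligibleS sub); apply: negligible_bigcup => n.
case: choice.unpickle => [i|]; first exact: F0.
exact: negligible_set0.
Qed.

End integral_off_null.

Section chain.
Context (R : realType) (T : countType) d (Omega : measurableType d).
Variables (P : probability Omega R) (q : T -> T -> R) (p : R -> T -> T -> R).
Variables (W : R -> Omega -> T) (s0 : T).
Hypothesis p_tf : transition_function q p.
Hypothesis W_meas : forall (t : R) i, 0 <= t -> measurable [set w | W t w = i].
Hypothesis W_right : forall (t : R) w, 0 <= t -> \forall u \near t^'+, W u w = W t w.
Hypothesis W_fdd : forall (n : nat) (t : nat -> R) (i : nat -> T),
  0 <= t 0%N -> (forall m, t m <= t m.+1) ->
  (P [set w | forall m, (m <= n)%N -> W (t m) w = i m]
   = P [set w | W (t 0%N) w = i 0%N]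
     * (\prod_(m < n) p (t m.+1 - t m) (i m) (i m.+1))%:E)%E.
Hypothesis W_init : P [set w | W 0 w = s0] = 1%E.

Lemma measurable_state (t : R) (A : set T) : 0 <= t ->
  measurable [set w | A (W t w)].
Proof.
move=> t0; rewrite (_ : [set w | A (W t w)] =
    \bigcup_i (if pselect (A i) then [set w | W t w = i] else set0)); last first.
  apply/seteqP; split=> [w Aw|w [i _]]; first by exists (W t w) => //; case: pselect.
  by case: (pselect (A i)) => [Ai /= Wi|//]; rewrite Wi.
apply: countable_bigcupT_measurable => [|i]; first exact: countableP.
by case: pselect => Ai; [exact: W_meas|exact: measurable0].
Qed.

Lemma measurable_fun_state (t : R) (phi : T -> \bar R) : 0 <= t ->
  measurable_fun setT (fun w => phi (W t w)).
Proof.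
move=> t0 _ B mB; rewrite setTI.
exact: (@measurable_state t (phi @^-1` B)).
Qed.

Lemma two_times (s t : R) i j : 0 <= s -> s <= t ->
  P [set w | W s w = i /\ W t w = j] = (P [set w | W s w = i] * (p (t - s) i j)%:E)%E.
Proof.
move=> s_ge0 st.
pose u (m : nat) := if m == 0%N then s else t.
pose k (m : nat) := if m == 0%N then i else j.
have := @W_fdd 1 u k s_ge0; rewrite big_ord1 => <-; last by case.
congr (P _); apply/seteqP; split=> [w [Wi Wj] [|[|//]]//|w Wk].
by split; [exact: (Wk 0%N)|exact: (Wk 1%N)].
Qed.

Lemma law_at (t : R) i : 0 <= t -> P [set w | W t w = i] = (p t s0 i)%:E.
Proof.
move=> t0; have m0 : measurable [set w | W 0 w = s0] by exact: W_meas.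
have mt : measurable [set w | W t w = i] by exact: W_meas.
have := two_times s0 i (lexx 0) t0; rewrite W_init mul1e subr0 => <-.
rewrite (measureDI _ mt m0) [X in (X + _)%E](_ : _ = 0%E) ?add0e.
  by congr (P _); apply/seteqP; split=> w [].
apply/eqP; rewrite -measure_le0; have -> : 0%E = P (~` [set w | W 0 w = s0]).
  by rewrite probability_setC// W_init subee.
by apply: le_measure; rewrite ?inE; [exact: measurableD|exact: measurableC|move=> w []].
Qed.

Lemma expectation_at (t : R) (phi : T -> R) : 0 <= t -> (forall i, 0 <= phi i) ->
  (\int[P]_w (phi (W t w))%:E = avg p t (EFin \o phi) s0)%E.
Proof.
move=> t0 phi0.
pose F k := [set w | choice.pickle (W t w) = k].
have FT : setT = \bigcup_k F k.
  by apply/seteqP; split=> // w _; exists (choice.pickle (W t w)).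
rewrite FT ge0_integral_bigcup; last first.
- move=> i j _ _ [w [/= <- <-]] //.
- by move=> w _; rewrite lee_fin.
- by rewrite -FT; exact: (measurable_fun_state (EFin \o phi)).
- by move=> k; exact: (@measurable_state t [set i | choice.pickle i = k]).
pose a k : \bar R :=
  if pickle_inv k is Some i then ((p t s0 i)%:E * (phi i)%:E)%E else 0%E.
have p0 i : 0 <= p t s0 i by case: p_tf => + _ _ _ _; apply.
have a0 k : (0 <= a k)%E.
  by rewrite /a; case: pickle_inv => // i; rewrite -EFinM lee_fin mulr_ge0.
transitivity (\sum_(0 <= k <oo) a k)%E.
  apply: eq_eseriesr => k _; rewrite /a; have := @pickle_invK T k.
  case E : pickle_inv => [i|] /= => [ik|_]; last first.
    have -> : F k = set0.
      apply/seteqP; split=> w //= Wk; move: E.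
      by rewrite -Wk pickleK_inv.
    exact: integral_set0.
  rewrite -law_at//.
  have -> : F k = [set w | W t w = i].
    rewrite /F; apply/seteqP; split=> w /=; last by move=> ->.
    by rewrite -ik => /(pcan_inj choice.pickleK).
  rewrite muleC -integral_cst; last exact: W_meas.
  by apply: eq_integral => w; rewrite inE /= => ->.
rewrite nneseries_esumT// (@esumID _ _ (range (@choice.pickle T) : set nat))//.
rewrite [X in (_ + X)%E]esum1 ?adde0; last first.
  move=> k [_ /= npk]; rewrite /a; case E : pickle_inv => [i|//].
  by case: npk; exists i => //; have := @pickle_invK T k; rewrite E.
rewrite setTI esum_image => [|i j _ _]; last exact: (pcan_inj choice.pickleK).
by apply: eq_esum => i _; rewrite /a pickleK_inv.
Qed.

Variable D : set T.
Hypothesis D_absorbing :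
  forall (t : R) i j, 0 <= t -> D i -> j != i -> p t i j = 0.

(** Rational times suffice, the paths being right-continuous. *)
Definition leaves : set Omega := [set w | exists r r' : rat,
  [/\ 0 <= ratr r :> R, ratr r <= ratr r' :> R, D (W (ratr r) w)
    & W (ratr r') w <> W (ratr r) w]].

Lemma leaves_negligible : P.-negligible leaves.
Proof.
pose F (x : rat * rat * T * T) : set Omega :=
  let: (r, r', i, j) := x in
  if [&& 0 <= ratr r :> R, ratr r <= ratr r' :> R, `[< D i >] & j != i]
  then [set w | W (ratr r) w = i /\ W (ratr r') w = j] else set0.
have sub : leaves `<=` \bigcup_x F x.
  move=> w [r [r' [r0 rr' Dr Wrr']]].
  exists (r, r', W (ratr r) w, W (ratr r') w) => //=; rewrite ifT//.
  by apply/and4P; split=> //; [exact/asboolP|exact/eqP].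
apply: (negligibleS sub); apply: negligible_countable => -[[[r r'] i] j] /=.
case: ifPn => [/and4P[r0 rr' /asboolP Di ji]|_]; last exact: negligible_set0.
have mF : measurable [set w | W (ratr r) w = i /\ W (ratr r') w = j].
  by apply: measurableI; apply: W_meas => //; exact: le_trans rr'.
apply/(negligibleP _ mF).
by rewrite /= two_times// D_absorbing ?mule0 ?subr_ge0.
Qed.

Definition hitting_time (w : Omega) : \bar R :=
  ereal_inf [set t%:E | t in [set t : R | 0 <= t /\ D (W t w)]].

(** By right-continuity the chain is in [D] at the infimum, and stays where it is
    until some later rational time. *)
Lemma hitting_time_attained w : (hitting_time w < +oo)%E ->
  exists tau : R, [/\ 0 <= tau, hitting_time w = tau%:E, D (W tau w)
    & exists2 r : rat, tau < ratr r & W (ratr r) w = W tau w].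
Proof.
move=> hit_fin; pose S := [set t : R | 0 <= t /\ D (W t w)].
have [s0' Ss] : S !=set0.
  by have [_ [t St <-] _] := ereal_inf_lt hit_fin; exists t.
have S_lb : has_lbound S by exists 0 => t [].
have S_inf : has_inf S by split => //; exists s0'.
have tau0 : 0 <= inf S by apply: lb_le_inf; [exists s0'|move=> t []].
have [e /= e0 eW] := W_right w tau0.
have W_const u : inf S < u < inf S + e -> W u w = W (inf S) w.
  move=> /andP[u1 u2]; apply: eW => //=.
  by rewrite ltr_norml; apply/andP; split; lra.
have D_tau : D (W (inf S) w).
  have [t St tlt] := inf_adherent e0 S_inf.
  have := ge_inf S_lb St; rewrite le_eqVlt => /predU1P[->|tau_t]; first by case: St.
  by rewrite -(W_const t) ?tau_t//; case: St.
exists (inf S); split=> //; first by rewrite -ereal_inf_EFin//; exists s0'.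
have [r] := @rat_in_itvoo R (inf S) (inf S + e) (ltr_pwDr e0 (lexx _)).
rewrite in_itv/= => /andP[r1 r2]; exists r => //.
by apply: W_const; rewrite r1.
Qed.

Lemma eventually_hit w : ~ leaves w -> (hitting_time w < +oo)%E ->
  \forall n \near \oo, W n%:R w = W (fine (hitting_time w)) w.
Proof.
move=> w_stays /hitting_time_attained[tau [tau0 -> Dtau [r tau_r Wr]]] /=.
exists (Num.truncn (ratr r : R)).+1 => // n /= rn.
rewrite -Wr; apply: contrapT => Wn; apply: w_stays; exists r, n%:R.
have r0 : 0 <= ratr r :> R by rewrite (le_trans tau0)// ltW.
rewrite ratr_nat; split=> //; last by rewrite Wr.
by rewrite ltW// (lt_le_trans (truncnS_gt _))// ler_nat.
Qed.

Lemma measurable_hit : measurable [set w | (hitting_time w < +oo)%E].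
Proof.
rewrite (_ : [set _ | _] = \bigcup_(r : rat)
    (if 0 <= ratr r :> R then [set w | D (W (ratr r) w)] else set0)).
  apply: countable_bigcupT_measurable => [|r]; first exact: countableP.
  by case: ifP => [r0|_]; [exact: measurable_state|exact: measurable0].
apply/seteqP; split=> [w /hitting_time_attained[tau [tau0 _ Dtau [r tau_r Wr]]]|w [r _]].
  by exists r => //; rewrite (le_trans tau0 (ltW tau_r))/= Wr.
case: ifP => // r0 /= Dr; apply: (@le_lt_trans _ _ (ratr r)%:E); last exact: ltry.
by apply: ereal_inf_lbound; exists (ratr r).
Qed.

Definition hit_value (phi : T -> R) (w : Omega) : \bar R :=
  if (hitting_time w < +oo)%E then (phi (W (fine (hitting_time w)) w))%:E else 0%E.

(** Almost surely the chain is eventually constant once it has entered [D], and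
    [phi] vanishes as long as it has not: dominated convergence applies. *)
Lemma cvg_avg_hit (phi : T -> R) (f : Omega -> \bar R) :
  (forall i, 0 <= phi i <= 1) -> (forall i, ~ D i -> phi i = 0) ->
  (forall w, (0 <= f w)%E) -> P.-negligible [set w | f w <> hit_value phi w] ->
  (avg p n%:R (EFin \o phi) s0 @[n --> \oo] --> \int[P]_w f w)%E.
Proof.
move=> phi01 phiD f0 f_hit.
have phi0 i : 0 <= phi i by case/andP: (phi01 i).
have [N [mN N0 exceptN]] := negligibleU leaves_negligible f_hit.
pose G n (w : Omega) : \bar R := if w \in N then 0%E else (phi (W n%:R w))%:E.
pose g (w : Omega) : \bar R := if w \in N then 0%E else f w.
have mW n : measurable_fun setT (fun w => (phi (W n%:R w))%:E).
  exact: (measurable_fun_state (EFin \o phi)).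
have G_patch n : G n = (fun w => (phi (W n%:R w))%:E) \_ (~` N).
  by apply/funext => w; rewrite patchE in_setC /G; case: (w \in N).
have mG n : measurable_fun setT (G n).
  rewrite G_patch; apply/(measurable_restrictT _ (measurableC mN)).1.
  exact: measurable_funTS.
have G_cvg w : G n w @[n --> \oo] --> g w.
  rewrite /G /g; case: ifPn => [_|/negP wN]; first exact: cvg_cst.
  have w_stays : ~ leaves w by move=> w_leaves; apply/wN/mem_set/exceptN; left.
  have -> : f w = hit_value phi w.
    by apply: contrapT => fw; apply/wN/mem_set/exceptN; right.
  rewrite /hit_value; case: ifPn => [hit_fin|/negP hit_inf].
    apply: cvg_near_cst; near=> n; congr (phi _)%:E; near: n.
    exact: eventually_hit.
  apply: cvg_near_cst; near=> n; rewrite phiD// => Dn; apply: hit_inf.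
  apply: (@le_lt_trans _ _ n%:R%:E); last exact: ltry.
  by apply: ereal_inf_lbound; exists n%:R.
have mg : measurable_fun setT g.
  by apply: (emeasurable_fun_cvg G) => // w _; exact: G_cvg.
have int_G n : (\int[P]_w G n w = avg p n%:R (EFin \o phi) s0)%E.
  rewrite -expectation_at//; apply/esym/(integral_off_null mN) => //.
  - by move=> w; rewrite lee_fin.
  - by move=> w wN; rewrite /G memNset.
  - by move=> w wN; rewrite /G mem_set.
have int_g : (\int[P]_w f w = \int[P]_w g w)%E.
  apply: (integral_off_null mN) => //.
  - by move=> w wN; rewrite /g memNset.
  - by move=> w wN; rewrite /g mem_set.
rewrite int_g; under eq_cvg do rewrite -int_G.
have [] := @dominated_convergence _ _ _ P setT measurableT G g (cst 1%E) mG mg.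
- by apply: aeW => w _; exact: G_cvg.
- exact: finite_measure_integrable_cst.
- apply: aeW => w n _; rewrite /G; case: ifP => _ /=; first by rewrite normr0 lee_fin.
  by rewrite lee_fin ger0_norm//; case/andP: (phi01 (W n%:R w)).
by [].
Unshelve. all: by end_near. Qed.

End chain.

(** * Roots and the semigroup of the process *)

Section extinction_probability.
Context (R : realType) (b : 'I_2 -> Zp2 -> R) (R1 R2 : {fset Zp2}).
Hypothesis b_rates : offspring_rates b.
Hypothesis b_A2 : assumption_A2 b.
Hypothesis R1_neq0 : R1 != fset0.
Hypothesis R2_neq0 : R2 != fset0.
Hypothesis b_R1 : forall m, m \in R1 -> 0 < b 0 m.
Hypothesis b_R2 : forall m, m \in R2 -> 0 < b 1 m.

Lemma positive_rate_neq_evec a m : 0 < b a m -> m != evec a.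
Proof.
apply: contraTneq => ->.
by rewrite -leNgt -oppr_ge0 death_ge0.
Qed.

Lemma evec_notin_R1 : evec 0 \notin R1.
Proof. by apply/negP => /b_R1/positive_rate_neq_evec; rewrite eqxx. Qed.

Lemma evec_notin_R2 : evec 1 \notin R2.
Proof. by apply/negP => /b_R2/positive_rate_neq_evec; rewrite eqxx. Qed.

Lemma split_gf_ones_lt (y : R1 -> R) (z : R2 -> R) a m0 :
  (forall m, 0 <= y m <= 1) -> (forall m, 0 <= z m <= 1) ->
  m0 != evec a ->
  (split_gf b y z a (ones R)
    <= (- b a (evec a) - b a m0 * (1 - mark2 y z a m0))%:E)%E.
Proof.
move=> y01 z01 m0e.
have Fe : [set` [fset m0]%fset] `<=` [set m | m != evec a] by move=> m /= /fset1P ->.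
rewrite EFinB -(b_evec b_rates) leeBrDr// /split_gf.
have onesE m : xpow (ones R) m = 1 by rewrite /xpow big1// => c _; rewrite mxE expr1n.
rewrite !(esumD_fset Fe); last 2 first.
- by move=> m /= me; rewrite lee_fin (b_ge0 b_rates).
- move=> m /= me; have /andP[? _] := mark2_01 a m y01 z01.
  by rewrite onesE mulr1 lee_fin mulr_ge0 ?(b_ge0 b_rates).
rewrite !big_seq_fset1 addeAC -EFinD onesE mulr1 leeD//.
  by rewrite lee_fin; lra.
apply: le_esum => m [/= me _]; have /andP[? ?] := mark2_01 a m y01 z01.
by rewrite onesE mulr1 lee_fin ler_piMr ?(b_ge0 b_rates).
Qed.

Lemma death_gt0 a : 0 < - b a (evec a).
Proof.
have [m0 m0_gt0] : exists m, 0 < b a m.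
  case: (ord2P a) => ->; [have /fset0Pn[m /b_R1 ?] := R1_neq0|
    have /fset0Pn[m /b_R2 ?] := R2_neq0]; by exists m.
apply: (lt_le_trans m0_gt0); rewrite -lee_fin -(b_evec b_rates).
have Fe : [set` [fset m0]%fset] `<=` [set m | m != evec a].
  by move=> m /= /fset1P ->; exact: positive_rate_neq_evec.
by have := @esum_ge_finite R _ _ (fun m => (b a m)%:E) _ Fe; rewrite big_seq_fset1.
Qed.

(** Each type has a marked offspring vector of positive rate, whose mark is below
    1. *)
Lemma uniform_gap (y : R1 -> R) (z : R2 -> R) :
  (forall m, 0 <= y m < 1) -> (forall m, 0 <= z m < 1) ->
  exists2 k, 0 < k &
    forall a, (split_gf b y z a (ones R) <= (- b a (evec a) - k)%:E)%E.
Proof.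
move=> y01 z01.
have y01' m : 0 <= y m <= 1 by have /andP[-> /ltW] := y01 m.
have z01' m : 0 <= z m <= 1 by have /andP[-> /ltW] := z01 m.
have /fset0Pn[m1 m1R] := R1_neq0; have /fset0Pn[m2 m2R] := R2_neq0.
have gap1 : 0 < b 0 m1 * (1 - mark2 y z 0 m1).
  rewrite mulr_gt0 ?b_R1// subr_gt0 /mark2 /= /mark insubT//.
  by case/andP: (y01 (Sub m1 m1R)).
have gap2 : 0 < b 1 m2 * (1 - mark2 y z 1 m2).
  rewrite mulr_gt0 ?b_R2// subr_gt0 /mark2 /= /mark insubT//.
  by case/andP: (z01 (Sub m2 m2R)).
exists (Num.min (b 0 m1 * (1 - mark2 y z 0 m1)) (b 1 m2 * (1 - mark2 y z 1 m2))).
  by rewrite lt_min gap1 gap2.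
move=> a; case: (ord2P a) => ->.
  apply: le_trans (split_gf_ones_lt y01' z01' (positive_rate_neq_evec (b_R1 m1R))) _.
  by rewrite lee_fin lerD2l lerN2 ge_min lexx.
apply: le_trans (split_gf_ones_lt y01' z01' (positive_rate_neq_evec (b_R2 m2R))) _.
by rewrite lee_fin lerD2l lerN2 ge_min lexx orbT.
Qed.

Let C : R := fine (mean b 0 0) + fine (mean b 0 1)
  + (fine (mean b 1 0) + fine (mean b 1 1)).

Let C_ge0 : 0 <= C.
Proof. by rewrite !addr_ge0// fine_ge0// mean_ge0. Qed.

Let b_mean a :
  (\esum_(m in [set m | m != evec a]) (b a m * (total m)%:R)%:E <= C%:E)%E.
Proof.
rewrite esum_total// -(fineK (mean_fin b_rates b_A2 a 0)).
rewrite -(fineK (mean_fin b_rates b_A2 a 1)) -EFinD lee_fin /C.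
have m0 i l : 0 <= fine (mean b i l) by rewrite fine_ge0// mean_ge0.
by case: (ord2P a) => ->; rewrite ?lerDl ?lerDr addr_ge0.
Qed.

Variable p : R -> state R1 R2 -> state R1 R2 -> R.
Hypothesis p_tf : transition_function (@qtilde R b R1 R2) p.

(** The maximum principle applied to the indicator of the other states. *)
Lemma extinct_absorbing (t : R) (s s' : state R1 R2) :
  0 <= t -> s.1.1 = zvec -> s' != s -> p t s s' = 0.
Proof.
move=> t0 s_ext s's.
have p_ge0 i j : 0 <= p t i j by case: p_tf => + _ _ _ _; apply.
pose U (j : state R1 R2) : R := (j != s)%:R.
have U01 j : 0 <= U j <= 1 by rewrite /U; case: (_ != _); rewrite /= ?lexx ?ler01.
have U_drift j : (\esum_(j' in [set j' | j' != j]) (qtilde b j j' * U j')%:E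
    <= ((- 0 - qtilde b j j) * U j)%:E)%E.
  rewrite oppr0 sub0r; have [->|js] := eqVneq j s.
    rewrite esum1 => [|j' _]; last by rewrite qtilde_extinct ?mul0r.
    by rewrite /U eqxx mulr0.
  rewrite {2}/U js mulr1 -(qtilde_conservative b_rates evec_notin_R1 evec_notin_R2).
  apply: le_esum => j' /= jj'; rewrite lee_fin ler_piMr//.
    exact: qtilde_ge0 evec_notin_R1 evec_notin_R2 _ _ jj'.
  by case/andP: (U01 j').
have := avg_qtilde_decay b_rates evec_notin_R1 evec_notin_R2 C_ge0 b_mean p_tf
  s (lexx 0) t0 U01 U_drift.
rewrite {2}/U eqxx mulr0 => U_le0.
apply/eqP; rewrite eq_le p_ge0 andbT -lee_fin (le_trans _ U_le0)//.
have := @esum_ge_finite R _ setT (fun j => ((p t s j)%:E * (EFin \o U) j)%E)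
  [fset s']%fset.
by rewrite big_seq_fset1 /U /= s's mule1; apply.
Qed.

Let s0 k : state R1 R2 := (evec k, [ffun => 0%N], [ffun => 0%N]).

Lemma state_gf_init (u : 'rV[R]_2) (y : R1 -> R) (z : R2 -> R) k :
  state_gf u y z (s0 k) = u 0 k.
Proof.
rewrite /state_gf /= xpow_evec /cpow !big1 ?mulr1// => m _;
  by rewrite ffunE expr0.
Qed.

Lemma avg_extinct_gf_le_root (y : R1 -> R) (z : R2 -> R) u (t : R) k :
  (forall m, 0 <= y m <= 1) -> (forall m, 0 <= z m <= 1) ->
  0 <= t -> unit_square u ->
  (forall a, split_gf b y z a u = (- b a (evec a) * u 0 a)%:E) ->
  (avg p t (EFin \o extinct_gf y z) (s0 k) <= (u 0 k)%:E)%E.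
Proof.
move=> y01 z01 t0 u01 uroot; rewrite -(state_gf_init u y z).
exact: (avg_extinct_gf_le b_rates evec_notin_R1 evec_notin_R2 C_ge0 b_mean p_tf).
Qed.

(** Since the limit does not depend on [u], this also shows that the root is
    unique. *)
Lemma cvg_extinct_gf (y : R1 -> R) (z : R2 -> R) u k :
  (forall m, 0 <= y m < 1) -> (forall m, 0 <= z m < 1) ->
  unit_square u ->
  (forall a, split_gf b y z a u = (- b a (evec a) * u 0 a)%:E) ->
  (avg p n%:R (EFin \o extinct_gf y z) (s0 k) @[n --> \oo] --> (u 0 k)%:E)%E.
Proof.
move=> y01 z01 u01 uroot; have [kap kap0 kapP] := uniform_gap y01 z01.
have y01' m : 0 <= y m <= 1 by have /andP[-> /ltW] := y01 m.
have z01' m : 0 <= z m <= 1 by have /andP[-> /ltW] := z01 m.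
apply: (@squeeze_cvge _ _ _ _ (fun n => (u 0 k - expR (- (kap * n%:R)))%:E)
  _ (fun=> (u 0 k)%:E)).
- apply: nearW => n; apply/andP; split.
    rewrite -(state_gf_init u y z).
    exact: (avg_extinct_gf_ge b_rates evec_notin_R1 evec_notin_R2 C_ge0 b_mean p_tf
      y01' z01' (s0 k) (ltW kap0)).
  exact: avg_extinct_gf_le_root.
- apply/cvg_EFin; first by apply: nearW.
  rewrite -[X in _ --> X]subr0; apply: cvgB; first exact: cvg_cst.
  under eq_cvg do rewrite -mulNr expRM_natr.
  apply: cvg_expr; rewrite ger0_norm ?expR_ge0// expR_lt1.
  by rewrite oppr_lt0.
- exact: cvg_cst.
Qed.

End extinction_probability.

(** * The process *)

Section process.
Context (R : realType) (b : 'I_2 -> Zp2 -> R) (R1 R2 : {fset Zp2}).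
Hypothesis b_rates : offspring_rates b.
Hypothesis b_A2 : assumption_A2 b.
Hypothesis R1_neq0 : R1 != fset0.
Hypothesis R2_neq0 : R2 != fset0.
Hypothesis b_R1 : forall m, m \in R1 -> 0 < b 0 m.
Hypothesis b_R2 : forall m, m \in R2 -> 0 < b 1 m.
Context d (Omega : measurableType d) (P : probability Omega R).
Variables (X : R -> Omega -> Zp2) (Y : R -> Omega -> counts R1)
  (Z : R -> Omega -> counts R2) (k : 'I_2).

Let W (t : R) (w : Omega) : state R1 R2 := (X t w, Y t w, Z t w).

Hypothesis W_chain : markov_chain (@qtilde R b R1 R2) P W.
Hypothesis W_init : P [set w | [/\ X 0 w = evec k, Y 0 w = [ffun => 0%N]
                                 & Z 0 w = [ffun => 0%N]]] = 1%E.

Let dead : set (state R1 R2) := [set s | s.1.1 = zvec].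
Let s0 : state R1 R2 := (evec k, [ffun => 0%N], [ffun => 0%N]).

Let W_init' : P [set w | W 0 w = s0] = 1%E.
Proof.
rewrite -W_init; congr (P _); apply/seteqP; split=> w /=.
  by case=> -> -> ->.
by rewrite /W => -[-> -> ->].
Qed.

Lemma measurable_extinct : measurable (extinct X).
Proof.
by have [W_meas W_right _] := W_chain; exact: (measurable_hit W_meas W_right dead).
Qed.

Lemma extinct_zvec w : extinct X w -> X (fine (extinction_time X w)) w = zvec.
Proof.
have [W_meas W_right _] := W_chain => w_ext.
have [tau [_ tauE tau_dead _]] := @hitting_time_attained _ _ _ _ _ W_right dead w w_ext.
by rewrite -[extinction_time X w]/(hitting_time W dead w) tauE; exact: tau_dead.
Qed.

Lemma marked_ge0 (y : R1 -> R) (z : R2 -> R) w :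
  (forall m, 0 <= y m <= 1) -> (forall m, 0 <= z m <= 1) ->
  0 <= marked_at_extinction X Y Z y z w.
Proof.
move=> y01 z01; rewrite /marked_at_extinction.
have /andP[? _] := cpow01 (Y (fine (extinction_time X w)) w) y01.
have /andP[? _] := cpow01 (Z (fine (extinction_time X w)) w) z01.
exact: mulr_ge0.
Qed.

Lemma hit_value_marked (y : R1 -> R) (z : R2 -> R) w : extinct X w ->
  hit_value W dead (extinct_gf y z) w = (marked_at_extinction X Y Z y z w)%:E.
Proof.
move=> w_ext; rewrite /hit_value ifT//.
by rewrite /extinct_gf /= -/(extinction_time X w) extinct_zvec// eqxx mul1r.
Qed.

Lemma hit_value_not_extinct (y : R1 -> R) (z : R2 -> R) w : ~ extinct X w ->
  hit_value W dead (extinct_gf y z) w = 0%E.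
Proof. by move=> w_ext; rewrite /hit_value ifF//; apply/negP. Qed.

(** One transition function serves for all marks, which makes the generating
    functions for different marks comparable. *)
Definition limits_are_integrals (p : R -> state R1 R2 -> state R1 R2 -> R) :=
  transition_function (@qtilde R b R1 R2) p /\
  forall (y : R1 -> R) (z : R2 -> R) (f : Omega -> \bar R),
    (forall m, 0 <= y m <= 1) -> (forall m, 0 <= z m <= 1) ->
    (forall w, (0 <= f w)%E) ->
    P.-negligible [set w | f w <> hit_value W dead (extinct_gf y z) w] ->
    (avg p n%:R (EFin \o extinct_gf y z) s0 @[n --> \oo] --> \int[P]_w f w)%E.

Lemma cvg_avg_extinct : exists p, limits_are_integrals p.
Proof.
have [W_meas W_right [p p_tf W_fdd]] := W_chain; exists p; split=> //.
move=> y z f y01 z01 f0 fE.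
apply: (@cvg_avg_hit _ _ _ _ _ _ _ _ _ p_tf W_meas W_right W_fdd W_init' dead) => //.
- move=> t i j t0 i_dead ji.
  exact: (extinct_absorbing b_rates b_A2 b_R1 b_R2 p_tf t0 i_dead ji).
- by move=> i; exact: extinct_gf01.
- by move=> i /eqP i_alive; rewrite /extinct_gf (negbTE i_alive) mul0r.
Qed.

Lemma integral_marked (y : R1 -> R) (z : R2 -> R) (f : Omega -> \bar R) :
  (forall m, 0 <= y m < 1) -> (forall m, 0 <= z m < 1) ->
  (forall w, (0 <= f w)%E) ->
  P.-negligible [set w | f w <> hit_value W dead (extinct_gf y z) w] ->
  (\int[P]_w f w = (qroot b y z 0 k)%:E)%E.
Proof.
move=> y01 z01 f0 fE; have [p [p_tf p_cvg]] := cvg_avg_extinct.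
have y01' m : 0 <= y m <= 1 by have /andP[-> /ltW] := y01 m.
have z01' m : 0 <= z m <= 1 by have /andP[-> /ltW] := z01 m.
have [q01 qP] := qroot_root b_rates (evec_notin_R1 b_rates b_R1)
  (evec_notin_R2 b_rates b_R2)
  (death_gt0 b_rates R1_neq0 R2_neq0 b_R1 b_R2) y01' z01'.
rewrite -(cvg_lim (@ereal_hausdorff R) (p_cvg y z f y01' z01' f0 fE)).
apply: (cvg_lim (@ereal_hausdorff R)).
exact: (cvg_extinct_gf b_rates b_A2 R1_neq0 R2_neq0 b_R1 b_R2 p_tf y01 z01 q01 qP).
Qed.

(** At most [qmin]: the chain is compared with the harmonic function attached to
    [qmin]. At least [qmin]: the probability dominates the generating function of
    the marks, hence the least roots for all marks below 1, whose limit is a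
    supersolution. *)
Lemma probability_extinct : P (extinct X) = (qmin b 0 k)%:E.
Proof.
have [p [p_tf p_cvg]] := cvg_avg_extinct.
have death0 := death_gt0 b_rates R1_neq0 R2_neq0 b_R1 b_R2.
have one01 (S : {fset Zp2}) : forall m : S, 0 <= (1 : R) <= 1.
  by move=> m; rewrite ler01 lexx.
pose y1 (m : R1) : R := 1; pose z1 (m : R2) : R := 1.
pose f w : \bar R := (\1_(extinct X) w)%:E.
have f_cvg : (avg p n%:R (EFin \o extinct_gf y1 z1) s0 @[n --> \oo]
    --> P (extinct X))%E.
  rewrite -[P (extinct X)](_ : \int[P]_w f w = _)%E; last first.
    by rewrite integral_indic ?setIT//; exact: measurable_extinct.
  apply: p_cvg; [exact: one01|exact: one01|by move=> w; rewrite lee_fin|].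
  rewrite (_ : [set _ | _] = set0); first exact: negligible_set0.
  apply/seteqP; split=> // w /=; apply; rewrite /f indicE.
  have [w_ext|w_ext] := pselect (extinct X w).
    rewrite mem_set// hit_value_marked// /marked_at_extinction /cpow !big1 ?mulr1//.
      by move=> m _; rewrite expr1n.
    by move=> m _; rewrite expr1n.
  by rewrite memNset// hit_value_not_extinct.
have P_fin : P (extinct X) \is a fin_num by exact: fin_num_measure measurable_extinct.
rewrite (qminE R1 R2 b_rates death0).
set L := least_root b _ _.
have [L01 _] := least_root_supersolution b_rates death0 (conj (one01 R1) (one01 R2)).
have Lroot a := least_rootP b_rates death0 a (conj (one01 R1) (one01 R2)).
apply/eqP; rewrite eq_le; apply/andP; split.
  rewrite -(cvg_lim (@ereal_hausdorff R) f_cvg).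
  apply: lime_le; first by apply/cvg_ex; exists (P (extinct X)).
  apply: nearW => n.
  exact: (avg_extinct_gf_le_root b_rates b_A2 b_R1 b_R2 p_tf k
    (one01 R1) (one01 R2) (ler0n R n) L01 Lroot).
rewrite -(fineK P_fin) lee_fin; apply: least_root_approx => // c c01.
pose yc (m : R1) : R := c; pose zc (m : R2) : R := c.
have c01' : 0 <= c <= 1 by have /andP[-> /ltW] := c01.
have yc01 m : 0 <= yc m <= 1 by [].
have zc01 m : 0 <= zc m <= 1 by [].
have [Lc01 _] := least_root_supersolution b_rates death0 (conj yc01 zc01).
have Lcroot a := least_rootP b_rates death0 a (conj yc01 zc01).
have c_cvg : (avg p n%:R (EFin \o extinct_gf yc zc) s0 @[n --> \oo]
    --> (least_root b yc zc 0 k)%:E)%E.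
  exact: (cvg_extinct_gf b_rates b_A2 R1_neq0 R2_neq0 b_R1 b_R2 p_tf
    (fun=> c01) (fun=> c01) Lc01 Lcroot).
rewrite -lee_fin fineK//.
rewrite -(cvg_lim (@ereal_hausdorff R) c_cvg) -(cvg_lim (@ereal_hausdorff R) f_cvg).
apply: lee_lim.
- by apply/cvg_ex; eexists; exact: c_cvg.
- by apply/cvg_ex; eexists; exact: f_cvg.
apply: nearW => n; apply: (avg_le p_tf) => // j; rewrite lee_fin.
rewrite /extinct_gf ler_wpM2l//.
have cpow_le (S : {fset Zp2}) (l : counts S) :
    cpow (fun=> c) l <= cpow (fun=> 1 : R) l.
  have -> : cpow (fun=> 1 : R) l = 1 by rewrite /cpow big1// => m _; rewrite expr1n.
  by have /andP[] := @cpow01 R S (fun=> c) l (fun=> c01').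
have cpow_ge (S : {fset Zp2}) (l : counts S) : 0 <= cpow (fun _ : S => c) l.
  by have /andP[] := @cpow01 R S (fun=> c) l (fun=> c01').
by rewrite ler_pM.
Qed.

End process.

Theorem theorem3p3 (R : realType) (b : 'I_2 -> Zp2 -> R) (R1 R2 : {fset Zp2})
    (hb : offspring_rates b)
    (hA1 : assumption_A1 b) (hA2 : assumption_A2 b) (hA3 : assumption_A3 b)
    (hR1 : R1 != fset0) (hR2 : R2 != fset0)
    (hbR1 : forall m, m \in R1 -> 0 < b 0 m)
    (hbR2 : forall m, m \in R2 -> 0 < b 1 m)
    (d : measure_display) (Omega : measurableType d) (P : probability Omega R)
    (X : R -> Omega -> Zp2) (Y : R -> Omega -> counts R1)
    (Z : R -> Omega -> counts R2) (k : 'I_2)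
    (hXYZ : markov_chain (@qtilde R b R1 R2) P
              (fun t w => (X t w, Y t w, Z t w)))
    (hinit : P [set w | [/\ X 0 w = evec k, Y 0 w = [ffun => 0%N]
                          & Z 0 w = [ffun => 0%N]]] = 1%E) :
  (rho1 b <= 0 ->
     P (extinct X) = 1%E /\
     forall (y : R1 -> R) (z : R2 -> R),
       (forall m, 0 <= y m < 1) -> (forall m, 0 <= z m < 1) ->
       ('E_P[marked_at_extinction X Y Z y z] = (qroot b y z 0 k)%:E)%E) /\
  (0 < rho1 b -> (0 < P (extinct X))%E ->
     forall (y : R1 -> R) (z : R2 -> R),
       (forall m, 0 <= y m < 1) -> (forall m, 0 <= z m < 1) ->
       cond_expectation P (extinct X) (marked_at_extinction X Y Z y z)
       = qroot b y z 0 k / qmin b 0 k).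
Proof.
have death0 := death_gt0 hb hR1 hR2 hbR1 hbR2.
have integralE (y : R1 -> R) (z : R2 -> R) :
    (forall m, 0 <= y m < 1) -> (forall m, 0 <= z m < 1) ->
    (\int[P]_(w in extinct X) (marked_at_extinction X Y Z y z w)%:E
     = (qroot b y z 0 k)%:E)%E.
  move=> y01 z01.
  have y01' m : 0 <= y m <= 1 by have /andP[-> /ltW] := y01 m.
  have z01' m : 0 <= z m <= 1 by have /andP[-> /ltW] := z01 m.
  rewrite integral_mkcond.
  apply: (integral_marked hb hA2 hR1 hR2 hbR1 hbR2 hXYZ hinit y01 z01).
    by move=> w; rewrite patchE; case: ifP => // _; rewrite lee_fin marked_ge0.
  rewrite (_ : [set _ | _] = set0); first exact: negligible_set0.
  apply/seteqP; split=> // w /=; apply; rewrite patchE.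
  have [w_ext|w_ext] := pselect (extinct X w).
    by rewrite mem_set// (hit_value_marked hXYZ).
  by rewrite memNset// (hit_value_not_extinct Y Z).
have P_ext := probability_extinct hb hA2 hR1 hR2 hbR1 hbR2 hXYZ hinit.
split=> [rho_le0|_ _ y z y01 z01]; last first.
  by rewrite /cond_expectation integralE// P_ext.
have P_ext1 : P (extinct X) = 1%E.
  rewrite P_ext (qminE R1 R2 hb death0); congr EFin.
  have one01 (S : {fset Zp2}) : forall m : S, 0 <= (1 : R) <= 1.
    by move=> m; rewrite ler01 lexx.
  have [L01 _] := least_root_supersolution hb death0 (conj (one01 R1) (one01 R2)).
  apply: (subcritical_root hb hA2 hA1 hA3 rho_le0 L01) => a.
  rewrite -(split_gf_unmarked R1 R2).
  exact: (least_rootP hb death0 a (conj (one01 R1) (one01 R2))).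
split=> // y z y01 z01.
have y01' m : 0 <= y m <= 1 by have /andP[-> /ltW] := y01 m.
have z01' m : 0 <= z m <= 1 by have /andP[-> /ltW] := z01 m.
rewrite unlock.
apply: (integral_marked hb hA2 hR1 hR2 hbR1 hbR2 hXYZ hinit y01 z01).
  by move=> w; rewrite lee_fin marked_ge0.
have mext := measurable_extinct hXYZ.
exists (~` extinct X); split; first exact: measurableC.
  by rewrite probability_setC// P_ext1 subee.
by move=> w /= w_hit w_ext; apply: w_hit; rewrite (hit_value_marked hXYZ).
Qed.
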